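(* Consider, on a mesh of cells $\{\mathcal I_k\}$, the first-order Lax-Friedrichs scheme $$\overline{\mathbf W}_k^{n+1}=\overline{\mathbf W}_k^n-\frac{\Delta t_n}{|\mathcal I_k|}\sum_{j\in\mathcal N_k}|\mathcal E_{kj}|\,\widehat{\mathbf H}_{kj}+\Delta t_n\mathbf S(\overline{\mathbf W}_k^n),$$ $$\widehat{\mathbf H}_{kj}=\tfrac12\xi_{kj,\ell}\Big(\mathbf H^\ell(\overline{\mathbf W}_k^n)+\mathbf H^\ell(\overline{\mathbf W}_j^n)\Big)-\tfrac{a_{kj}}2\big(\overline{\mathbf W}_j^n-\overline{\mathbf W}_k^n\big),\qquad a_{kj}\ge\max\{\eta_{\xi_{kj}}(\overline{\mathbf W}_k^n),\eta_{\xi_{kj}}(\overline{\mathbf W}_j^n)\}.$$ Assume $\overline{\mathbf W}_k^0\in\mathcal G_*$ for all $k$. Then the scheme is physical-constraint-preserving, i.e. $\overline{\mathbf W}_k^n\in\mathcal G_*$ for all $k$ and all $n\ge0$, under the CFL-type condition (imposed at every time step $n$) $$\Delta t_n\max_k\bigg(\frac{1}{2|\mathcal I_k|}\sum_{j\in\mathcal N_k}a_{kj}|\mathcal E_{kj}|+\lambda_{\rm S}(\overline{\mathbf W}_k^n)\bigg)<1,$$ where $\lambda_{\rm S}(\overline{\mathbf W}_k^n)=0$ if $q(\mathbf S(\overline{\mathbf W}_k^n))\ge0$, and otherwise $\lambda_{\rm S}(\overline{\mathbf W}_k^n)>0$ is the solution of $q\big(\overline{\mathbf W}_k^n+\lambda_{\rm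 S}^{-1}\mathbf S(\overline{\mathbf W}_k^n)\big)=0$.
   Context: Conventions: Greek indices 0 to 3, Latin indices 1 to 3, $x^0=t$, repeated tensor indices summed. The spacetime metric is given and smooth: $g_{00}=-(\alpha^2-\beta_i\beta^i)$, $g_{0i}=\beta_i$, $g_{ij}=\gamma_{ij}$, with lapse $\alpha>0$, shift $\beta^i$, and 3-metric $(\gamma_{ij})$ symmetric positive definite with inverse $\boldsymbol\Upsilon=(\gamma^{ij})$, $\gamma=\det(\gamma_{ij})$, $\sqrt{-g}=\alpha\sqrt\gamma$; $\Gamma^\lambda_{\mu\nu}$ are the Christoffel symbols. Spatial indices are raised/lowered with $\gamma^{ij},\gamma_{ij}$. Equation of state (EOS): $e(p,\rho)$ is $C^1$ on $(0,\infty)^2$, $h=1+e+p/\rho$, and for all $p,\rho>0$: $h\ge\sqrt{1+p^2/\rho^2}+p/\rho$; $h(\frac1\rho-\partial_ph)<\partial_\rho h<0$; $\lim_{p\to0^+}e=0$, $\lim_{p\to+\infty}e=+\infty$ for fixed $\rho$. Ideal EOS: $h=1+\frac{\Gamma p}{(\Gamma-1)\rho}$, $\Gamma\in(1,2]$. Sound speed: $c_s^2=h^{-1}\partial_\rho h/(\frac1\rho-\partial_ph)\in(0,1)$. Physical state: primitive variables $\rho>0$, $p>0$, $\mathbf v=(v_1,v_2,v_3)$ with $v=\sqrt{v_jv^j}<1$, Lorentz factor $w=(1-v^2)^{-1/2}$; $\mathbf U=(D,\mathbf m,E)^\top$, $D=\rho w$, $\mathbf m=\rho hw^2\mathbf v$,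 $E=\rho hw^2-p$. This is a bijection onto $\mathcal G_\gamma=\{D>0,\ E>\sqrt{D^2+\mathbf m\boldsymbol\Upsilon\mathbf m^\top}\}$. Flux $\mathbf F^i=(D\tilde v^i,\tilde v^i\mathbf m+p\mathbf e_i,E\tilde v^i+pv^i)^\top$, $\tilde v^i=v^i-\beta^i/\alpha$, $\mathbf e_i$ the $i$-th row of the $3\times3$ identity. Source $\mathbf Q=\big(0,\ T^{\mu\nu}(\partial_\mu g_{\nu j}-\Gamma^\delta_{\nu\mu}g_{\delta j})_{j=1,2,3},\ \alpha(T^{\mu0}\partial_\mu\ln\alpha-T^{\mu\nu}\Gamma^0_{\nu\mu})\big)^\top$, where $T^{\mu\nu}=\rho hu^\mu u^\nu+pg^{\mu\nu}$, $u^0=w/\alpha$, $u^i=w\tilde v^i$. W-form: $\partial_t\mathbf W+\partial_{x^j}\mathbf H^j(\mathbf W)=\mathbf S(\mathbf W)$, where $\mathbf W=\sqrt\gamma\,\boldsymbol\Sigma\mathbf U$, $\boldsymbol\Sigma=\mathrm{diag}\{1,R,1\}$ with $R^\top R=\boldsymbol\Upsilon$ (e.g. the upper triangular Cholesky factor), $\mathbf H^j=\sqrt{-g}\,\boldsymbol\Sigma\mathbf F^j$, $\mathbf S=\sqrt\gamma\,\frac{\partial\boldsymbol\Sigma}{\partial t}\mathbf U+\sqrt{-g}\big(\mathbf Q+\frac{\partial\boldsymbol\Sigma}{\partial x^j}\mathbf F^j\big)$. (The first component of $\mathbf S$ is $0$.) $\mathcal G_*=\{\mathbf W=(W_0,\dots,W_4)^\top: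 W_0>0,\ q(\mathbf W)>0\}$ with $q(\mathbf W)=W_4-(\sum_{i=0}^3W_i^2)^{1/2}$; $\mathbf U\in\mathcal G_\gamma\iff\mathbf W\in\mathcal G_*$. Speed bound: for $\boldsymbol\xi\ne\mathbf0$ and $\mathbf W\in\mathcal G_*$, $\eta_\xi(\mathbf W)=\alpha\varrho_\xi$ with $\varrho_\xi=\sqrt{\xi_j\xi^j}+|\xi_j\beta^j|/\alpha$ for a general EOS; for the ideal EOS one may also take $\varrho_\xi=\frac{1}{1-v^2c_s^2}\{|\xi_jv^j|(1-c_s^2)+c_sw^{-1}\sqrt{(1-v^2c_s^2)\xi_j\xi^j-(1-c_s^2)(\xi_jv^j)^2}\}+|\xi_j\beta^j|/\alpha$. Mesh: the three-dimensional spatial coordinate domain is divided into polyhedral cells $\mathcal I_k$ (possibly unstructured, e.g. tetrahedra or hexahedra with flat faces) of volume $|\mathcal I_k|$; $\mathcal N_k$ is the index set of neighboring cells of $\mathcal I_k$; $\mathcal E_{kj}=\partial\mathcal I_k\cap\partial\mathcal I_j$ is the common face, with area $|\mathcal E_{kj}|$ and (Euclidean) unit normal $\boldsymbol\xi_{kj}=(\xi_{kj,1},\xi_{kj,2},\xi_{kj,3})$ pointing from $\mathcal I_k$ to $\mathcal I_j$; the faces $\mathcal E_{kj}$, $j\in\mathcal N_k$, make up $\partial\mathcal I_k$. $\Delta t_n>0$ is the time step. $\mathbf H^\ell(\overline{\mathbf W}_k^n)$, $\mathbf S(\overline{\mathbf W}_k^n)$ and $\eta_{\xi_{kj}}(\overline{\mathbf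 W}_k^n)$ are evaluated with the metric quantities at the center of cell $\mathcal I_k$ at time $t_n$. *)

(* Defs.v *)
From HB Require Import structures.
From mathcomp Require Import all_boot all_order all_algebra.
From mathcomp Require Import all_classical all_reals all_analysis.

Set Implicit Arguments.
Unset Strict Implicit.
Unset Printing Implicit Defensive.

Import Order.TTheory GRing.Theory Num.Theory.
Import numFieldNormedType.Exports.

Local Open Scope classical_set_scope.
Local Open Scope ring_scope.

(* Tensor index 0 is time; the spatial index i : 'I_3 is the spacetime index
   [lift ord0 i : 'I_4]. *)
Definition tix : 'I_4 := ord0.
Definition six (i : 'I_3) : 'I_4 := lift ord0 i.

Definition event (R : realType) (t : R) (x : 'rV[R]_3) : 'rV[R]_4 :=
  (row_mx t%:M x : 'rV[R]_(1 + 3)).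

Definition dotp (R : realType) (u v : 'rV[R]_3) : R := (u *m v^T) 0 0.

(** * Smooth functions of the spacetime coordinates *)

Definition pder (R : realType) (mu : 'I_4) (f : 'rV[R]_4 -> R)
    (x : 'rV[R]_4) : R :=
  'D_(delta_mx 0 mu : 'rV[R]_4) f x.

Definition mxpder (R : realType) (m n : nat) (mu : 'I_4)
    (A : 'rV[R]_4 -> 'M[R]_(m, n)) (x : 'rV[R]_4) : 'M[R]_(m, n) :=
  \matrix_(i, j) pder mu (fun y => A y i j) x.

(* Class C^n on the open set Om. *)
Fixpoint Ck (R : realType) (n : nat) (Om : set 'rV[R]_4)
    (f : 'rV[R]_4 -> R) : Prop :=
  (forall x, Om x -> {for x, continuous f}) /\
  (if n is n'.+1 then
     forall mu : 'I_4,
       (forall x, Om x -> derivable f x (delta_mx 0 mu : 'rV[R]_4)) /\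
       Ck n' Om (pder mu f)
   else True).

Definition smooth (R : realType) (Om : set 'rV[R]_4) (f : 'rV[R]_4 -> R) : Prop :=
  forall n, Ck n Om f.

(** * The spacetime metric in 3+1 form *)

(* [shift_up] has the contravariant components beta^i. [gam_root] is the field of
   matrices R with R^T R = (gamma^{ij}). *)
Record adm (R : realType) := Adm {
  lapse : 'rV[R]_4 -> R;
  shift_up : 'rV[R]_4 -> 'rV[R]_3;
  gam : 'rV[R]_4 -> 'M[R]_3;
  gam_root : 'rV[R]_4 -> 'M[R]_3 }.

Definition Ups (R : realType) (M : adm R) (x : 'rV[R]_4) : 'M[R]_3 :=
  invmx (gam M x).

(* Square norm with respect to gamma^{ij} of covariant components. *)
Definition normsq (R : realType) (M : adm R) (x : 'rV[R]_4) (u : 'rV[R]_3) : R :=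
  dotp (u *m Ups M x) u.

Definition sqrtgam (R : realType) (M : adm R) (x : 'rV[R]_4) : R :=
  Num.sqrt (\det (gam M x)).

(* sqrt(-g) = alpha sqrt(gamma) *)
Definition sqrtmg (R : realType) (M : adm R) (x : 'rV[R]_4) : R :=
  lapse M x * sqrtgam M x.

Definition shift_low (R : realType) (M : adm R) (x : 'rV[R]_4) : 'rV[R]_3 :=
  shift_up M x *m gam M x.

Definition metric4 (R : realType) (M : adm R) (x : 'rV[R]_4) : 'M[R]_4 :=
  (block_mx (- (lapse M x ^+ 2 - dotp (shift_low M x) (shift_up M x)))%:M
            (shift_low M x) (shift_low M x)^T (gam M x) : 'M[R]_(1 + 3)).

Definition christoffel (R : realType) (M : adm R) (x : 'rV[R]_4)
    (l m n : 'I_4) : R :=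
  2^-1 * \sum_(s < 4) invmx (metric4 M x) l s *
    (pder m (fun y => metric4 M y s n) x + pder n (fun y => metric4 M y s m) x
     - pder s (fun y => metric4 M y m n) x).

Record is_spacetime (R : realType) (Om : set 'rV[R]_4) (M : adm R) : Prop := {
  st_open : open Om;
  st_smooth : forall mu nu, smooth Om (fun x => metric4 M x mu nu);
  st_lapse : forall x, Om x -> 0 < lapse M x;
  st_sym : forall x, Om x -> (gam M x)^T = gam M x;
  st_posdef : forall x, Om x ->
    forall u : 'rV[R]_3, u != 0 -> 0 < dotp (u *m gam M x) u;
  st_root : forall x, Om x -> (gam_root M x)^T *m gam_root M x = Ups M x;
  st_rootC1 : forall i j, Ck 1 Om (fun x => gam_root M x i j) }.

(** * Equation of state e(p, rho) *)

Definition enth (R : realType) (e : R -> R -> R) (p rho : R) : R :=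
  1 + e p rho + p / rho.

Definition dp (R : realType) (f : R -> R -> R) (p rho : R) : R :=
  derive1 (fun p' => f p' rho) p.

Definition drho (R : realType) (f : R -> R -> R) (p rho : R) : R :=
  derive1 (f p) rho.

Record is_eos (R : realType) (e : R -> R -> R) : Prop := {
  eos_dp : forall p rho, 0 < p -> 0 < rho -> derivable (fun p' => e p' rho) p 1;
  eos_drho : forall p rho, 0 < p -> 0 < rho -> derivable (e p) rho 1;
  eos_dp_cont : forall p rho, 0 < p -> 0 < rho ->
    {for (p, rho), continuous (fun z : R * R => dp e z.1 z.2)};
  eos_drho_cont : forall p rho, 0 < p -> 0 < rho ->
    {for (p, rho), continuous (fun z : R * R => drho e z.1 z.2)};
  eos_rel : forall p rho, 0 < p -> 0 < rho ->
    Num.sqrt (1 + p ^+ 2 / rho ^+ 2) + p / rho <= enth e p rho;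
  eos_causal : forall p rho, 0 < p -> 0 < rho ->
    enth e p rho * (rho^-1 - dp (enth e) p rho) < drho (enth e) p rho < 0;
  eos_lim0 : forall rho, 0 < rho -> e p rho @[p --> 0^'+] --> (0 : R);
  eos_limy : forall rho, 0 < rho -> e p rho @[p --> +oo] --> +oo }.

Definition is_ideal (R : realType) (Gam : R) (e : R -> R -> R) : Prop :=
  1 < Gam <= 2 /\
  forall p rho, 0 < p -> 0 < rho ->
    enth e p rho = 1 + Gam * p / ((Gam - 1) * rho).

Definition soundsq (R : realType) (e : R -> R -> R) (p rho : R) : R :=
  (enth e p rho)^-1 * drho (enth e) p rho / (rho^-1 - dp (enth e) p rho).

(** * Physical states, flux and source *)

(* Primitive variables (rho, p, v), v in covariant components v_j. *)
Definition prim (R : realType) : Type := (R * R * 'rV[R]_3)%type.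
Definition dens (R : realType) (V : prim R) : R := V.1.1.
Definition pres (R : realType) (V : prim R) : R := V.1.2.
Definition vel (R : realType) (V : prim R) : 'rV[R]_3 := V.2.

Definition speed (R : realType) (M : adm R) (x : 'rV[R]_4) (V : prim R) : R :=
  Num.sqrt (normsq M x (vel V)).

Definition phys (R : realType) (M : adm R) (x : 'rV[R]_4) (V : prim R) : Prop :=
  [/\ 0 < dens V, 0 < pres V & speed M x V < 1].

Definition lorentz (R : realType) (M : adm R) (x : 'rV[R]_4) (V : prim R) : R :=
  (Num.sqrt (1 - speed M x V ^+ 2))^-1.

(* v^i *)
Definition velup (R : realType) (M : adm R) (x : 'rV[R]_4) (V : prim R) :
    'rV[R]_3 :=
  vel V *m Ups M x.

(* v^i - beta^i / alpha *)
Definition velt (R : realType) (M : adm R) (x : 'rV[R]_4) (V : prim R) :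
    'rV[R]_3 :=
  velup M x V - (lapse M x)^-1 *: shift_up M x.

Definition enthV (R : realType) (e : R -> R -> R) (V : prim R) : R :=
  enth e (pres V) (dens V).

Definition consD (R : realType) (M : adm R) (x : 'rV[R]_4) (V : prim R) : R :=
  dens V * lorentz M x V.

Definition consm (R : realType) (e : R -> R -> R) (M : adm R) (x : 'rV[R]_4)
    (V : prim R) : 'rV[R]_3 :=
  (dens V * enthV e V * lorentz M x V ^+ 2) *: vel V.

Definition consE (R : realType) (e : R -> R -> R) (M : adm R) (x : 'rV[R]_4)
    (V : prim R) : R :=
  dens V * enthV e V * lorentz M x V ^+ 2 - pres V.

Definition state (R : realType) (D : R) (m : 'rV[R]_3) (E : R) : 'cV[R]_5 :=
  (col_mx D%:M (col_mx m^T E%:M) : 'cV[R]_(1 + (3 + 1))).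

Definition consU (R : realType) (e : R -> R -> R) (M : adm R) (x : 'rV[R]_4)
    (V : prim R) : 'cV[R]_5 :=
  state (consD M x V) (consm e M x V) (consE e M x V).

Definition fluxF (R : realType) (e : R -> R -> R) (M : adm R) (x : 'rV[R]_4)
    (V : prim R) (i : 'I_3) : 'cV[R]_5 :=
  state (consD M x V * velt M x V 0 i)
        (velt M x V 0 i *: consm e M x V + pres V *: delta_mx 0 i)
        (consE e M x V * velt M x V 0 i + pres V * velup M x V 0 i).

(* u^mu *)
Definition fourvel (R : realType) (M : adm R) (x : 'rV[R]_4) (V : prim R) :
    'rV[R]_4 :=
  (row_mx (lorentz M x V / lapse M x)%:M (lorentz M x V *: velt M x V)
    : 'rV[R]_(1 + 3)).

(* T^{mu nu} *)
Definition stress (R : realType) (e : R -> R -> R) (M : adm R) (x : 'rV[R]_4)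
    (V : prim R) (mu nu : 'I_4) : R :=
  dens V * enthV e V * fourvel M x V 0 mu * fourvel M x V 0 nu
  + pres V * invmx (metric4 M x) mu nu.

Definition sourceQ (R : realType) (e : R -> R -> R) (M : adm R) (x : 'rV[R]_4)
    (V : prim R) : 'cV[R]_5 :=
  state 0
    (\row_(j < 3) \sum_(mu < 4) \sum_(nu < 4) stress e M x V mu nu *
       (pder mu (fun y => metric4 M y nu (six j)) x
        - \sum_(d < 4) christoffel M x d nu mu * metric4 M x d (six j)))
    (lapse M x *
      (\sum_(mu < 4) stress e M x V mu tix * pder mu (fun y => ln (lapse M y)) x
       - \sum_(mu < 4) \sum_(nu < 4)
           stress e M x V mu nu * christoffel M x tix nu mu)).

(** * The W-form *)

Definition Sigma (R : realType) (M : adm R) (x : 'rV[R]_4) : 'M[R]_5 :=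
  (block_mx 1%:M 0 0 (block_mx (gam_root M x) 0 0 1%:M : 'M[R]_(3 + 1))
    : 'M[R]_(1 + (3 + 1))).

Definition Wof (R : realType) (e : R -> R -> R) (M : adm R) (x : 'rV[R]_4)
    (V : prim R) : 'cV[R]_5 :=
  sqrtgam M x *: (Sigma M x *m consU e M x V).

(* The primitive variables of W: the physical state with [Wof e M x V = W],
   which exists and is unique when W is in G_*. *)
Definition primW (R : realType) (e : R -> R -> R) (M : adm R) (x : 'rV[R]_4)
    (W : 'cV[R]_5) : prim R :=
  xget (0, 0, 0) [set V : R * R * 'rV[R]_3 | phys M x V /\ Wof e M x V = W].

Definition fluxH (R : realType) (e : R -> R -> R) (M : adm R) (x : 'rV[R]_4)
    (W : 'cV[R]_5) (j : 'I_3) : 'cV[R]_5 :=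
  sqrtmg M x *: (Sigma M x *m fluxF e M x (primW e M x W) j).

Definition sourceS (R : realType) (e : R -> R -> R) (M : adm R) (x : 'rV[R]_4)
    (W : 'cV[R]_5) : 'cV[R]_5 :=
  let V := primW e M x W in
  sqrtgam M x *: (mxpder tix (Sigma M) x *m consU e M x V)
  + sqrtmg M x *: (sourceQ e M x V
      + \sum_(j < 3) mxpder (six j) (Sigma M) x *m fluxF e M x V j).

Definition qfun (R : realType) (W : 'cV[R]_5) : R :=
  W ord_max 0 - Num.sqrt (\sum_(i < 5 | (i < 4)%N) W i 0 ^+ 2).

Definition Gstar (R : realType) : set 'cV[R]_5 :=
  [set W : 'cV[R]_5 | 0 < W ord0 0 /\ 0 < qfun W].

(* S stands for the source term S(W). *)
Definition lambdaS (R : realType) (W S : 'cV[R]_5) : R :=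
  if 0 <= qfun S then 0
  else xget 0 [set l : R | 0 < l /\ qfun (W + l^-1 *: S) = 0].

(** * Speed bounds *)

Definition shiftspeed (R : realType) (M : adm R) (x : 'rV[R]_4)
    (xi : 'rV[R]_3) : R :=
  `|dotp xi (shift_up M x)| / lapse M x.

Definition eta_general (R : realType) (M : adm R) (xi : 'rV[R]_3)
    (x : 'rV[R]_4) (W : 'cV[R]_5) : R :=
  lapse M x * (Num.sqrt (normsq M x xi) + shiftspeed M x xi).

Definition eta_ideal (R : realType) (e : R -> R -> R) (M : adm R)
    (xi : 'rV[R]_3) (x : 'rV[R]_4) (W : 'cV[R]_5) : R :=
  let V := primW e M x W in
  let v2 := speed M x V ^+ 2 in
  let cs2 := soundsq e (pres V) (dens V) in
  let xiv := dotp xi (velup M x V) in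
  lapse M x *
    ((1 - v2 * cs2)^-1 *
       (`|xiv| * (1 - cs2)
        + Num.sqrt cs2 * (lorentz M x V)^-1 *
          Num.sqrt ((1 - v2 * cs2) * normsq M x xi - (1 - cs2) * xiv ^+ 2))
     + shiftspeed M x xi).

Definition is_speed_bound (R : realType) (e : R -> R -> R) (M : adm R)
    (eta : 'rV[R]_3 -> 'rV[R]_4 -> 'cV[R]_5 -> R) : Prop :=
  eta = eta_general M \/
  (exists Gam, is_ideal Gam e) /\ eta = eta_ideal e M.

(** * Meshes of polyhedral cells *)

Definition boundary (R : realType) (A : set 'rV[R]_3) : set 'rV[R]_3 :=
  closure A `\` interior A.

Definition volume (R : realType) (A : set 'rV[R]_3) : R :=
  fine (((@lebesgue_measure R \x @lebesgue_measure R) \x @lebesgue_measure R)%E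
    [set z : R * R * R | A (\row_(i < 3) [:: z.1.1; z.1.2; z.2]`_i)]).

(* Area of a planar set A with unit normal xi: the Lebesgue measure of A in
   Cartesian coordinates on its plane, with origin o in A and orthonormal axes
   u, w orthogonal to xi. The value does not depend on the chosen frame. *)
Definition plane_frame (R : realType) (xi : 'rV[R]_3) (A : set 'rV[R]_3) :
    'rV[R]_3 * 'rV[R]_3 * 'rV[R]_3 :=
  xget (0, 0, 0) [set f | A f.1.1 /\
    [/\ dotp f.1.2 f.1.2 = 1, dotp f.2 f.2 = 1, dotp f.1.2 f.2 = 0,
        dotp f.1.2 xi = 0 & dotp f.2 xi = 0]].

Definition area (R : realType) (xi : 'rV[R]_3) (A : set 'rV[R]_3) : R :=
  let f := plane_frame xi A in
  fine ((@lebesgue_measure R \x @lebesgue_measure R)%E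
    [set z : R * R | A (f.1.1 + z.1 *: f.1.2 + z.2 *: f.2)]).

(* Interior of A relative to the plane through x with normal xi. *)
Definition relint (R : realType) (xi : 'rV[R]_3) (A : set 'rV[R]_3) :
    set 'rV[R]_3 :=
  [set x | A x /\ \forall y \near x, dotp xi (y - x) = 0 -> A y].

(* A mesh of the spatial domain X. The index type K may be infinite, and must
   be when it is nonempty: every part of the boundary of a cell is shared with
   another cell. A cell is a polyhedron: a compact regular closed set whose
   boundary consists of finitely many planar faces; it need not be convex. *)
Record mesh (R : realType) (X : set 'rV[R]_3) (K : eqType) := Mesh {
  cell : K -> set 'rV[R]_3;
  cell_center : K -> 'rV[R]_3;
  nbr : K -> seq K;
  unit_normal : K -> K -> 'rV[R]_3;
  face := fun k j => boundary (cell k) `&` boundary (cell j);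
  mesh_cover : \bigcup_k cell k = X;
  mesh_center : forall k, X (cell_center k);
  mesh_nonempty : forall k, cell k !=set0;
  mesh_compact : forall k, compact (cell k);
  mesh_regular : forall k, closure (interior (cell k)) = cell k;
  mesh_disjoint : forall k j, k != j ->
    interior (cell k) `&` interior (cell j) = set0;
  mesh_nbr_uniq : forall k, uniq (nbr k);
  mesh_nbr_irr : forall k, k \notin nbr k;
  mesh_boundary : forall k,
    \bigcup_(j in [set j | j \in nbr k]) face k j = boundary (cell k);
  mesh_unit : forall k j, j \in nbr k ->
    dotp (unit_normal k j) (unit_normal k j) = 1;
  mesh_flat : forall k j, j \in nbr k ->
    forall x y, face k j x -> face k j y -> dotp (unit_normal k j) (y - x) = 0;
  mesh_face : forall k j, j \in nbr k -> 0 < area (unit_normal k j) (face k j);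
  mesh_outward : forall k j, j \in nbr k ->
    forall x, relint (unit_normal k j) (face k j) x ->
      \forall s \near (0 : R)^'+,
        cell k (x - s *: unit_normal k j) /\ cell j (x + s *: unit_normal k j) }.

Definition volI (R : realType) (X : set 'rV[R]_3) (K : eqType) (T : mesh X K)
    (k : K) : R :=
  volume (cell T k).

Definition areaE (R : realType) (X : set 'rV[R]_3) (K : eqType) (T : mesh X K)
    (k j : K) : R :=
  area (unit_normal T k j) (face T k j).

(** * The Lax-Friedrichs scheme *)

(* Xk, Xj: the events (t_n, center of the cell k, resp. j). *)
Definition numflux (R : realType) (e : R -> R -> R) (M : adm R)
    (xi : 'rV[R]_3) (a : R) (Xk Xj : 'rV[R]_4) (Wk Wj : 'cV[R]_5) : 'cV[R]_5 :=
  2^-1 *: (\sum_(l < 3) xi 0 l *: (fluxH e M Xk Wk l + fluxH e M Xj Wj l))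
  - (a / 2) *: (Wj - Wk).

Definition LxF_update (R : realType) (e : R -> R -> R) (M : adm R)
    (X : set 'rV[R]_3) (K : eqType) (T : mesh X K) (t dt : R)
    (a : K -> K -> R) (W : K -> 'cV[R]_5) (k : K) : 'cV[R]_5 :=
  W k
  - (dt / volI T k) *: (\sum_(j <- nbr T k) areaE T k j *:
      numflux e M (unit_normal T k j) (a k j)
        (event t (cell_center T k)) (event t (cell_center T j)) (W k) (W j))
  + dt *: sourceS e M (event t (cell_center T k)) (W k).

(* The max over k is a supremum, as there may be infinitely many cells. *)
Definition CFL (R : realType) (e : R -> R -> R) (M : adm R)
    (X : set 'rV[R]_3) (K : eqType) (T : mesh X K) (t dt : R)
    (a : K -> K -> R) (W : K -> 'cV[R]_5) : Prop :=
  (dt%:E * ereal_sup (range (fun k =>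
     ((2 * volI T k)^-1 * (\sum_(j <- nbr T k) a k j * areaE T k j)
      + lambdaS (W k) (sourceS e M (event t (cell_center T k)) (W k)))%:E)) < 1)%E.

(* Main.v *)
(* The update of a cell is
     W_k' = (th W_k + dt S(W_k)) + dt / (2 |I_k|) sum_j |E_kj| (a_kj W_j - xi_kj.H(W_j)),
   with th = 1 - dt / (2 |I_k|) sum_j a_kj |E_kj|: the contributions of H(W_k) cancel
   because sum_j |E_kj| xi_kj = 0 for a polyhedron. The function q is concave and
   positively homogeneous, so it suffices to bound q below on each term. For the
   first one this is the definition of lambda_S and the CFL condition. For the others,
   the components E, D, m of a W - xi.H(W) in primitive variables satisfy
   E^2 - D^2 - |m|^2 = w^2 (b - v.xi)^2 A + p^2 (b^2 - |xi|^2), where b is the speed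
   corrected by the shift, and this is nonnegative beyond the given speed bound.
   The primitive variables of W are found by the intermediate value theorem in p.

   The identity sum_j |E_kj| xi_kj = 0 is proved one coordinate i at a time. Almost
   every line parallel to the axis i avoids the edges of the cell and of its neighbors;
   it enters and leaves the cell alternately, and at a face with normal xi the direction
   of the crossing is the sign of xi_i, so these signs add up to zero along the line.
   Integrating over all the lines gives the identity, as the projection along the axis i
   multiplies the area of a face by |xi_i|. *)

Require Import Defs.
From mathcomp Require Import all_boot all_order all_algebra.
From mathcomp Require Import all_classical all_reals all_analysis.
From mathcomp Require Import measurable_realfun.
From mathcomp Require Import ring lra.

Set Implicit Arguments.
Unset Strict Implicit.
Unset Printing Implicit Defensive.

Import Order.TTheory GRing.Theory Num.Theory.
Import numFieldNormedType.Exports.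
Local Open Scope classical_set_scope.
Local Open Scope ring_scope.

(** * Affine maps and Lebesgue measure *)

(** Uniqueness of Lebesgue measure: the pushforward by the affine map, scaled by [|a|], gives each
    interval []u, v]] its length. *)
Lemma lebesgue_measure_affine (R : realType) (a b : R) (A : set R) :
  a != 0 -> measurable A ->
  (@lebesgue_measure R [set x | A (a * x + b)%R] = `|a|^-1%:E * @lebesgue_measure R A)%E.
Proof.
move=> a0 mA.
pose f : measurableTypeR R -> measurableTypeR R := fun x => a * x + b.
have mf : measurable_fun setT f.
  by apply: measurable_funD => //; exact: measurable_funM.
have [m mE] : exists m : {measure set (measurableTypeR R) -> \bar R},
    forall B, m B = (`|a|%:E * @lebesgue_measure R (f @^-1` B))%E.
  pose m := measure_function_pushforward__canonical__measure_function_Measure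
    (@lebesgue_measure R) mf.
  by exists (mscale (NngNum (normr_ge0 a)) m).
suff -> : lebesgue_measure A = m A.
  by rewrite mE muleA -EFinM mulVf ?normr_eq0// mul1e.
apply: lebesgue_measure_unique => // _ [[u v]] _ <-.
rewrite mE /= .
have [a_gt0|a_lt0] := ltP 0 a.
- have -> : f @^-1` `]u, v]%classic = `](u - b) / a, (v - b) / a]%classic.
    apply/seteqP; split => x /=; rewrite !in_itv/= /f.
      by rewrite ltr_pdivrMr// ler_pdivlMr//; lra.
    by rewrite ltr_pdivrMr// ler_pdivlMr//; lra.
  rewrite !lebesgue_measure_itv/= !lte_fin ltr_pM2r ?invr_gt0// ltrD2r.
  case: ifP => _; last by rewrite mule0.
  by rewrite -!EFinD -EFinM gtr0_norm//; congr (_%:E); field.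
- have {a_lt0 a0} a_lt0 : a < 0 by rewrite lt_neqAle a0.
  have -> : f @^-1` `]u, v]%classic = `[(v - b) / a, (u - b) / a[%classic.
    apply/seteqP; split => x /=; rewrite !in_itv/= /f.
      by rewrite ltr_ndivlMr// ler_ndivrMr//; lra.
    by rewrite ltr_ndivlMr// ler_ndivrMr//; lra.
  rewrite !lebesgue_measure_itv/= !lte_fin ltr_nM2r ?invr_lt0// ltrD2r.
  case: ifP => _; last by rewrite mule0.
  rewrite -!EFinD -EFinM ltr0_norm//; congr (_%:E); field.
  by rewrite lt_eqF.
Qed.
Arguments lebesgue_measure_affine {R a} b {A}.

Section plane_measure.
Context {R : realType}.
Local Notation lam := (@lebesgue_measure R).
Local Notation lam2 := (lam \x lam)%E.

(** The two orders of iterated integration agree on rectangles, which determine the product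
    measure. *)
Lemma lebesgue2_ysection (A : set (R * R)) : measurable A ->
  (lam2 A = \int[lam]_y lam (ysection A y))%E.
Proof.
move=> mA; rewrite -[RHS]/((lam \x^ lam)%E A).
by apply: product_measure_unique => //= B C mB mC; rewrite product_measure2E.
Qed.

Lemma lebesgue2_swap (A : set (R * R)) : measurable A ->
  lam2 [set z | A (z.2, z.1)] = lam2 A.
Proof.
by move=> mA; rewrite [RHS]lebesgue2_ysection.
Qed.

(** On each line with [z.2] fixed the map is affine with slope [a]; the sections are then integrated
    over [z.2]. *)
Lemma lebesgue2_affine1 (a : R) (g : R -> R) (A : set (R * R)) :
  a != 0 -> measurable A -> measurable_fun setT g ->
  (lam2 [set z | A (a * z.1 + g z.2, z.2)%R] = `|a|^-1%:E * lam2 A)%E.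
Proof.
move=> a0 mA mg.
have mf : measurable_fun setT (fun z : R * R => (a * z.1 + g z.2, z.2)).
  apply: measurable_fun_pair => //; apply: measurable_funD.
    by apply: measurable_funM => //; exact: measurable_fst.
  exact: measurableT_comp.
rewrite lebesgue2_ysection; last by rewrite -[X in measurable X]setTI; exact: mf.
rewrite lebesgue2_ysection// -ge0_integralZl//; last first.
  exact: (measurable_fun_ysection lebesgue_measure mA).
apply: eq_integral => y _ /=; rewrite -(lebesgue_measure_affine (g y))//.
exact: measurable_ysection.
Qed.

Lemma lebesgue2_affine2 (a : R) (g : R -> R) (A : set (R * R)) :
  a != 0 -> measurable A -> measurable_fun setT g ->
  (lam2 [set z | A (z.1, a * z.2 + g z.1)%R] = `|a|^-1%:E * lam2 A)%E.
Proof.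
move=> a0 mA mg; rewrite -(lebesgue2_swap mA).
rewrite -(lebesgue2_affine1 (g := g))//; last first.
  by rewrite -[X in measurable X]setTI; exact: measurable_swap.
rewrite -lebesgue2_swap//.
  have mf : measurable_fun setT (fun z : R * R => (z.1, a * z.2 + g z.1)).
    apply: measurable_fun_pair => //; apply: measurable_funD.
      by apply: measurable_funM => //; exact: measurable_snd.
    exact: measurableT_comp.
by rewrite -[X in measurable X]setTI; exact: mf.
Qed.

(** Gaussian elimination: with pivot [a != 0] the map is a composite of two maps that each change
    one coordinate, with factors [a] and [(a * d - b * c) / a]. *)
Lemma lebesgue2_affine (a b c d p q : R) (A : set (R * R)) :
  a * d - b * c != 0 -> measurable A ->
  (lam2 [set z | A (a * z.1 + b * z.2 + p, c * z.1 + d * z.2 + q)%R] =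
   `|a * d - b * c|%R^-1%:E * lam2 A)%E.
Proof.
(* A zero pivot is avoided by exchanging the coordinates. *)
wlog a0 : a b c d p q A / a != 0.
  move=> wl D0 mA; have [a0|] := eqVneq a 0; last by move=> a0; exact: wl.
  have b0 : b != 0 by apply: contra_neq D0 => ->; rewrite a0; ring.
  rewrite -lebesgue2_swap; last first.
    have mf : measurable_fun setT (fun z : R * R =>
        (a * z.1 + b * z.2 + p, c * z.1 + d * z.2 + q)).
      apply: measurable_fun_pair; do 2 ?[apply: measurable_funD => //];
      by apply: measurable_funM => //;
        first [exact: measurable_fst|exact: measurable_snd].
    by rewrite -[X in measurable X]setTI; exact: mf.
  have -> : `|a * d - b * c| = `|b * c - a * d| by rewrite distrC.
  rewrite -(wl _ _ _ _ p q)//; last by rewrite -oppr_eq0 opprB.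
  by congr (lam2 _); apply/seteqP; split=> z /=; congr (A (_, _)); ring.
move=> D0 mA; pose D := a * d - b * c.
have -> : `|a * d - b * c|^-1%:E = (`|a|^-1%:E * `|D / a|^-1%:E)%E :> \bar R.
  by rewrite -EFinM -invfM -normrM mulrCA divff// mulr1.
rewrite -muleA.
(* The part of the second coordinate that depends on the new first coordinate
   [x = a * z.1 + b * z.2 + p]; the remainder is [D / a * z.2]. *)
pose g (x : R) := c / a * (x - p) + q.
have mg : measurable_fun setT g.
  apply: measurable_funD => //; apply: measurable_funM => //.
  exact: measurable_funB.
rewrite -(lebesgue2_affine2 (g := g))//; last by rewrite mulf_neq0// invr_eq0.
rewrite -(lebesgue2_affine1 (g := fun x => b * x + p))//.
- congr (lam2 _); apply/seteqP; split=> z /=; congr (A (_, _)); rewrite /g /D.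
  + by ring.
  + by field.
  + by ring.
  + by field.
- have mf : measurable_fun setT (fun z : R * R => (z.1, D / a * z.2 + g z.1)).
    apply: measurable_fun_pair => //; apply: measurable_funD.
      by apply: measurable_funM => //; exact: measurable_snd.
    exact: measurableT_comp.
  by rewrite -[X in measurable X]setTI; exact: mf.
- by apply: measurable_funD => //; exact: measurable_funM.
Qed.

Lemma lebesgue2_line (a b c : R) : (a != 0) || (b != 0) ->
  (lam2 [set z | a * z.1 + b * z.2 = c]%R = 0)%E.
Proof.
wlog b0 : a b / b != 0.
  move=> wl /orP[a0|b0]; last by apply: wl => //; rewrite b0 orbT.
  rewrite -[RHS](wl b a a0); last by rewrite a0 orbT.
  rewrite -[RHS]lebesgue2_swap//.
    congr (lam2 _); apply/seteqP; split=> z /=; rewrite addrC//.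
  have mf : measurable_fun setT (fun z : R * R => b * z.1 + a * z.2).
    by apply: measurable_funD => //; apply: measurable_funM => //;
        first [exact: measurable_fst|exact: measurable_snd].
  rewrite -[X in measurable X]setTI.
  exact: (mf measurableT [set c] (measurable_set1 c)).
move=> _; rewrite /product_measure1 integral0_eq//= => x _.
have -> : xsection [set z : R * R | a * z.1 + b * z.2 = c] x = [set (c - a * x) / b].
  apply/seteqP; split=> y; rewrite /xsection/= inE/=.
    by move=> <-; rewrite addrC addKr mulrC mulKf.
  by move=> ->; field.
exact: lebesgue_measure_set1.
Qed.

(** An open set is the union of the countably many rational boxes inside it. *)
Lemma open_measurable2 (A : set (R * R)) : open A -> measurable A.
Proof.
move=> oA.
pose box (q : rat * rat * rat) : set (R * R) :=
  ball (ratr q.1.1 : R) (ratr q.2) `*` ball (ratr q.1.2 : R) (ratr q.2).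
have -> : A = \bigcup_(q in [set q | box q `<=` A]) box q.
  apply/seteqP; split=> [z Az|z [q qA]]; last exact: qA.
  have /nbhs_ballP[e /= e0 eA] : nbhs z A by exact: open_nbhs_nbhs.
  have e20 : 0 < e / 2 by rewrite divr_gt0.
  have [r] := rat_in_itvoo e20; rewrite in_itv/= => /andP[r0 re].
  have [q1 q1z] : exists q1 : rat, `|z.1 - ratr q1| < ratr r.
    have [|q1] := @rat_in_itvoo _ (z.1 - ratr r) (z.1 + ratr r); first by lra.
    by rewrite in_itv/= => q1z; exists q1; rewrite ltr_norml; lra.
  have [q2 q2z] : exists q2 : rat, `|z.2 - ratr q2| < ratr r.
    have [|q2] := @rat_in_itvoo _ (z.2 - ratr r) (z.2 + ratr r); first by lra.
    by rewrite in_itv/= => q2z; exists q2; rewrite ltr_norml; lra.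
  exists (q1, q2, r); last by split; rewrite /ball/= distrC.
  move=> y [/= y1 y2]; apply: eA; split; rewrite /ball/=.
    rewrite -(subrKA (ratr q1)) (le_lt_trans (ler_normD _ _))//.
    by move: y1 q1z; rewrite /ball/=; lra.
  rewrite -(subrKA (ratr q2)) (le_lt_trans (ler_normD _ _))//.
  by move: y2 q2z; rewrite /ball/=; lra.
rewrite bigcup_mkcond; apply: countable_bigcupT_measurable => // q.
by case: ifP => // _; apply: measurableX; exact: measurable_ball.
Qed.

Lemma closed_measurable2 (A : set (R * R)) : closed A -> measurable A.
Proof.
by rewrite -openC => /open_measurable2 /measurableC; rewrite setCK.
Qed.

End plane_measure.

(** * Local structure of a mesh at its faces *)

Section half_space.
Context {R : realType}.
Implicit Types (x y z nu : 'rV[R]_3) (A : set 'rV[R]_3).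

Lemma dotpE x y : dotp x y = x 0 0 * y 0 0 + x 0 1 * y 0 1 + x 0 2 * y 0 2.
Proof.
rewrite /dotp mxE !big_ord_recl big_ord0 !mxE addr0 addrA.
by do ![congr (_ + _)|congr (_ * _)|congr (_ _ _)]; apply/val_inj.
Qed.

Lemma dotpDr x y z : dotp x (y + z) = dotp x y + dotp x z.
Proof. by rewrite !dotpE !mxE; ring. Qed.

Lemma dotpNr x y : dotp x (- y) = - dotp x y.
Proof. by rewrite !dotpE !mxE; ring. Qed.

Lemma dotpZr (a : R) x y : dotp x (a *: y) = a * dotp x y.
Proof. by rewrite !dotpE !mxE; ring. Qed.

Lemma nbhs_step y v (P : set 'rV[R]_3) : nbhs y P ->
  exists2 e : R, 0 < e & forall t : R, `|t| < e -> P (y + t *: v).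
Proof.
move=> yP; have c : (fun t : R => y + t *: v) @ (0 : R) --> y + 0 *: v.
  by apply: cvgD; [exact: cvg_cst|apply: cvgZr_tmp; exact: cvg_id].
move: c; rewrite scale0r addr0 => /(_ _ yP)/nbhs_ballP[e /= e0 eP].
by exists e => // t te; apply: eP; rewrite /ball/= sub0r normrN.
Qed.

(** Along the segment, the parameters of points in [A] form a closed set because [A] is closed, and
    an open one because these points are all interior; [[0, 1]] is connected. *)
Lemma segment_interior A x y : closed A -> A x ->
  (forall t : R, 0 <= t <= 1 -> ~ boundary A (x + t *: (y - x))) -> A y.
Proof.
move=> cA Ax nbd; pose g (t : R) := x + t *: (y - x).
have cg : continuous g.
  by move=> t; apply: cvgD; [exact: cvg_cst|apply: cvgZr_tmp; exact: cvg_id].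
have AI t : 0 <= t <= 1 -> A (g t) -> interior A (g t).
  move=> t01 At; apply: contrapT => nI; apply: (nbd t t01); split => //.
  exact: subset_closure.
have g0 : g 0 = x by rewrite /g scale0r addr0.
have g1 : g 1 = y by rewrite /g scale1r subrKC.
pose I := (`[0, 1]%classic : set R).
have /(_ (I `&` g @^-1` A)) E : connected I by exact: segment_connected.
have I0 : I 0 by rewrite /I/= in_itv/= lexx ler01.
have I1 : I 1 by rewrite /I/= in_itv/= lexx ler01.
suff [_] : (I `&` g @^-1` A) 1 by rewrite /= g1.
rewrite E//.
- by exists 0; split => //=; rewrite g0.
- exists (g @^-1` (interior A)).
    by apply: open_comp => //; exact: open_interior.
  apply/seteqP; split => t [It At]; split => //.
    by apply: AI => //; move: It; rewrite /I/= in_itv.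
  exact: interior_subset At.
- by exists (g @^-1` A) => //; apply: closed_comp.
Qed.

Lemma norm_convex x y z (e t : R) : 0 <= t <= 1 ->
  `|x - y| < e -> `|x - z| < e -> `|x - (y + t *: (z - y))| < e.
Proof.
move=> /andP[t0 t1] ye ze.
have -> : x - (y + t *: (z - y)) = (1 - t) *: (x - y) + t *: (x - z).
  by apply/rowP => i; rewrite !mxE; ring.
rewrite (le_lt_trans (ler_normD _ _))// !normrZ (ger0_norm t0) ger0_norm ?subr_ge0//.
move: ye ze; set a := `|x - y|; set b := `|x - z| => ae be.
by have [ab|/ltW ba] := leP a b; [apply: le_lt_trans be|apply: le_lt_trans ae]; nra.
Qed.

Lemma nbhs_norm_le x (P : set 'rV[R]_3) :
  nbhs x P <-> exists2 e : R, 0 < e & forall y, `|x - y| < e -> P y.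
Proof.
have E := @nbhs_normP R 'rV[R]_3 x P.
split=> [/E[e /= e0 eP]|[e e0 eP]]; first by exists e.
by apply/E; exists e.
Qed.

(* Near [x] the boundary lies in one plane, so each of the two open half balls
   is inside or outside [A]; as [A] is the closure of its interior, exactly one
   is inside. *)
Lemma local_half_space A nu x : closure (interior A) = A -> 0 < dotp nu nu ->
  boundary A x ->
  (\forall y \near x, boundary A y -> dotp nu (y - x) = 0) ->
  exists2 s : R, s \is a GRing.unit & \forall y \near x,
    [/\ 0 < s * dotp nu (y - x) -> interior A y,
        s * dotp nu (y - x) < 0 -> ~ A y &
        dotp nu (y - x) = 0 -> boundary A y].
Proof.
move=> rA nu0 [clAx nIx] /nbhs_norm_le[e e0 eP].
have cA : closed A by rewrite -rA; exact: closed_closure.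
have bdE y : boundary A y <-> A y /\ ~ interior A y.
  by rewrite /boundary -(proj1 (closure_id A) cA).
have Ax : A x by move: clAx; rewrite -(proj1 (closure_id A) cA).
(* Two points of the ball strictly on one side of the plane are joined by a segment off the
   boundary, so membership in [A] passes from one to the other. *)
have side s y z : `|x - y| < e -> `|x - z| < e -> 0 < s * dotp nu (y - x) ->
    0 < s * dotp nu (z - x) -> A y -> interior A z.
  move=> ye ze ys zs Ay.
  have nz t : 0 <= t <= 1 -> ~ boundary A (y + t *: (z - y)).
    move=> t01 /(eP _ (norm_convex t01 ye ze)).
    have -> : y + t *: (z - y) - x = (1 - t) *: (y - x) + t *: (z - x).
      by apply/rowP => i; rewrite !mxE; ring.
    rewrite dotpDr !dotpZr => /(congr1 ( *%R s)).
    rewrite mulr0 mulrDr mulrCA [s * (t * _)]mulrCA.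
    move: ys zs; set a := s * _; set b := s * _ => a0 b0.
    case/andP: t01 => t0 t1; apply/eqP; rewrite gt_eqF//.
    by have [ab|/ltW ba] := leP a b; [apply: lt_le_trans a0 _|apply: lt_le_trans b0 _]; nra.
  have Az := segment_interior cA Ay nz.
  apply: contrapT => nIz; have := nz 1; rewrite scale1r subrKC lexx ler01.
  by move=> /(_ isT); apply; apply/bdE.
have nbhs_e y : `|x - y| < e -> nbhs y [set z | `|x - z| < e].
  move=> ye; apply/nbhs_norm_le; exists (e - `|x - y|); rewrite ?subr_gt0// => z /=.
  move=> yz; rewrite -(subrKA y) (le_lt_trans (ler_normD _ _))//.
  by rewrite -ltrBrDl.
(* Interior points accumulate at [x]; one that lies in the plane is moved off it along [nu]. *)
have [y [Iy ye ny0]] : exists y, [/\ interior A y, `|x - y| < e & dotp nu (y - x) != 0].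
  have : closure (interior A) x by rewrite rA.
  move=> /(_ [set z | `|x - z| < e])[|y [Iy /= ye]].
    by apply: nbhs_e; rewrite subrr normr0.
  have [y0|] := eqVneq (dotp nu (y - x)) 0; last by exists y.
  have [d d0 dP] : exists2 d : R, 0 < d & forall t, `|t| < d ->
      (interior A `&` [set z | `|x - z| < e]) (y + t *: nu).
    apply: nbhs_step; apply: filterI; last exact: nbhs_e.
    by apply: open_nbhs_nbhs; split => //; exact: open_interior.
  have [|I1 e1] := dP (d / 2); first by rewrite gtr0_norm; lra.
  exists (y + (d / 2) *: nu); split => //.
  by rewrite addrAC dotpDr y0 add0r dotpZr mulf_neq0 ?gt_eqF//; lra.
pose s := dotp nu (y - x); exists s; first by rewrite unitfE.
have s2 : 0 < s * s by rewrite -expr2 exprn_even_gt0.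
have inside z : `|x - z| < e -> 0 < s * dotp nu (z - x) -> interior A z.
  by move=> ze sz; apply: (side s y z) => //; exact: interior_subset.
(* If the other side met [A] as well, both open half balls would lie in [A], hence by closedness
   also the disk between them, and [x] would be interior. *)
have outside z : `|x - z| < e -> s * dotp nu (z - x) < 0 -> ~ A z.
  move=> ze sz Az; apply: nIx; apply/nbhs_norm_le; exists e => // w we.
  have [w0|w0] := eqVneq (dotp nu (w - x)) 0; last first.
    have [sw|sw|/eqP] := ltgtP 0 (s * dotp nu (w - x)).
    - by apply: interior_subset; exact: inside.
    - by apply: interior_subset; apply: (side (- s) z w ze we _ _ Az); rewrite mulNr oppr_gt0.
    - by rewrite eq_sym mulf_eq0 (negPf w0) (negPf ny0).
  rewrite (proj1 (closure_id A) cA) => B wB.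
  have [d d0 dP] := nbhs_step (s *: nu) (filterI wB (nbhs_e _ we)).
  have [|Bt et] := dP (d / 2); first by rewrite gtr0_norm; lra.
  exists (w + (d / 2) *: (s *: nu)); split => //.
  apply: interior_subset; apply: inside => //.
  rewrite addrAC dotpDr w0 add0r !dotpZr.
  by have := mulr_gt0 (mulr_gt0 s2 nu0) d0; lra.
apply/nbhs_norm_le; exists e => // z ze; split; [exact: inside|exact: outside|].
move=> z0; apply/bdE; split.
  rewrite (proj1 (closure_id A) cA) => B zB.
  have [d d0 dP] := nbhs_step (s *: nu) (filterI zB (nbhs_e _ ze)).
  have [|Bt et] := dP (d / 2); first by rewrite gtr0_norm; lra.
  exists (z + (d / 2) *: (s *: nu)); split => //.
  apply: interior_subset; apply: inside => //.
  rewrite addrAC dotpDr z0 add0r !dotpZr.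
  by have := mulr_gt0 (mulr_gt0 s2 nu0) d0; lra.
move=> Iz.
have zI : nbhs z (interior A) by apply: open_nbhs_nbhs; split => //; exact: open_interior.
have [d d0 dP] := nbhs_step (- s *: nu) (filterI zI (nbhs_e _ ze)).
have [|It et] := dP (d / 2); first by rewrite gtr0_norm; lra.
apply: (outside _ et); last exact: interior_subset It.
rewrite addrAC dotpDr z0 add0r !dotpZr.
by have := mulr_gt0 (mulr_gt0 s2 nu0) d0; lra.
Qed.

End half_space.

Lemma near_all_in (T : Type) (F : set_system T) {FF : Filter F} (J : eqType)
    (s : seq J) (P : J -> set T) :
  (forall l, l \in s -> F (P l)) -> F [set y | forall l, l \in s -> P l y].
Proof.
elim: s => [|a s IH] h; first by apply: filterE => y l; rewrite in_nil.
have Fa : F (P a) by apply: h; rewrite mem_head.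
have {}IH : F [set y | forall l, l \in s -> P l y].
  by apply: IH => l ls; apply: h; rewrite in_cons ls orbT.
apply: filterS (filterI Fa IH) => y [Pa Ps] l.
by rewrite in_cons => /orP[/eqP->|/Ps].
Qed.

Section mesh_faces.
Context {R : realType} (X : set 'rV[R]_3) (K : eqType) (T : mesh X K).
Implicit Types (k j l : K) (x y z : 'rV[R]_3).

Lemma closed_boundary (A : set 'rV[R]_3) : closed (boundary A).
Proof.
rewrite /boundary setDE; apply: closedI; first exact: closed_closure.
by apply: open_closedC; exact: open_interior.
Qed.

Lemma cell_closed k : closed (cell T k).
Proof. by rewrite -(mesh_regular T k); exact: closed_closure. Qed.

(** The point [x] is not on an edge of the cell or of its neighbors. Planes are compared through the
    directions they contain, as normals of coplanar faces may be opposite. *)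
Definition coplanar_faces_at k x := forall k1 l1 k2 l2,
  k1 \in k :: nbr T k -> l1 \in nbr T k1 -> face T k1 l1 x ->
  k2 \in k :: nbr T k -> l2 \in nbr T k2 -> face T k2 l2 x ->
  forall z, dotp (unit_normal T k1 l1) z = 0 -> dotp (unit_normal T k2 l2) z = 0.

(** Faces are closed, so those that miss [x] stay away from it; the others lie in the same plane as
    [face T k j]. *)
Lemma boundary_near_face k j x k' : j \in nbr T k -> face T k j x ->
  coplanar_faces_at k x -> k' \in k :: nbr T k ->
  \forall y \near x, boundary (cell T k') y -> dotp (unit_normal T k j) (y - x) = 0.
Proof.
move=> jk xF cop k'k.
have : \forall y \near x, forall l, l \in nbr T k' -> face T k' l y -> face T k' l x.
  apply: near_all_in => l _.
  have [xl|xl] := pselect (face T k' l x); first exact: filterE.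
  have : nbhs x (~` face T k' l).
    apply: open_nbhs_nbhs; split => //; apply: closed_openC.
    by apply: closedI; exact: closed_boundary.
  by apply: filterS => y yl /yl.
apply: filterS => y yF; rewrite -(mesh_boundary T k') => -[l /= lk' yl].
have xl := yF l lk' yl.
apply: (cop k' l k j) => //; first by rewrite mem_head.
exact: (mesh_flat lk').
Qed.

(** Each of the two cells is a half ball near [x]; [mesh_outward] tells which one. *)
Lemma near_face k j x : j \in nbr T k -> face T k j x -> coplanar_faces_at k x ->
  \forall y \near x,
    (dotp (unit_normal T k j) (y - x) < 0 -> interior (cell T k) y) /\
    (0 < dotp (unit_normal T k j) (y - x) -> ~ cell T k y /\ interior (cell T j) y).
Proof.
move=> jk xF cop; set nu := unit_normal T k j.
have nu1 : dotp nu nu = 1 by exact: mesh_unit.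
have nu0 : 0 < dotp nu nu by rewrite nu1.
have [xk xj] := xF.
have kk : k \in k :: nbr T k by rewrite mem_head.
have jk' : j \in k :: nbr T k by rewrite in_cons jk orbT.
have [s su sP] := local_half_space (mesh_regular T k) nu0 xk
  (boundary_near_face jk xF cop kk).
have [s' su' sP'] := local_half_space (mesh_regular T j) nu0 xj
  (boundary_near_face jk xF cop jk').
(* Near [x] the whole plane belongs to both boundaries, so [mesh_outward] applies at [x]. *)
have xrel : relint nu (face T k j) x.
  split => //; apply: filterS (filterI sP sP') => y [[_ _ yk] [_ _ yj]] y0.
  by split; [exact: yk|exact: yj].
have step t : dotp nu (x + t *: nu - x) = t.
  by rewrite addrAC subrr add0r dotpZr nu1 mulr1.
have [e e0 eP] := nbhs_step nu (filterI sP sP').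
have [t [t0 te tk tj]] : exists t, [/\ 0 < t, `|t| < e,
    cell T k (x + (- t) *: nu) & cell T j (x + t *: nu)].
  have /nbhs_ballP[d /= d0 dP] := mesh_outward jk xrel.
  have t0 : 0 < Num.min d e / 2 by rewrite divr_gt0// lt_min d0.
  have td : Num.min d e / 2 < d by have : Num.min d e <= d by [rewrite ge_min lexx]; lra.
  have te : Num.min d e / 2 < e by have : Num.min d e <= e by [rewrite ge_min lexx orbT]; lra.
  exists (Num.min d e / 2); rewrite gtr0_norm//.
  have cd : ball (0 : R) d (Num.min d e / 2) by rewrite /ball/= sub0r normrN gtr0_norm.
  by have [] := dP _ cd t0; rewrite scaleNr.
have s_lt0 : s < 0.
  have [|[_ out _] _] := eP (- t); first by rewrite normrN.
  move: su; rewrite unitfE neq_lt => /orP[//|s0].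
  by case: out => //; rewrite step; nra.
have s'_gt0 : 0 < s'.
  have [_ [_ out _]] := eP t te.
  move: su'; rewrite unitfE neq_lt => /orP[s'0|//].
  by case: out => //; rewrite step; nra.
apply: filterS (filterI sP sP') => y [[yi yo _] [yi' _ _]].
split=> [y0|y0]; first by apply: yi; nra.
by split; [apply: yo; nra|apply: yi'; nra].
Qed.

(** A point just beyond [face T k j] is inside [j] and outside [k]. Normals at an acute angle put it
    inside [j'] too, against disjointness, and an obtuse angle puts it in [k]; coplanarity excludes
    a right angle. *)
Lemma face_unique k j j' x : j \in nbr T k -> j' \in nbr T k ->
  face T k j x -> face T k j' x -> coplanar_faces_at k x -> j = j'.
Proof.
move=> jk j'k xj xj' cop; apply/eqP; apply: contrapT => /negP jj'.
set nu := unit_normal T k j; set nu' := unit_normal T k j'.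
have [e e0 eP] := nbhs_step nu (filterI (near_face jk xj cop) (near_face j'k xj' cop)).
have [|[_ a] [b c]] := eP (e / 2); first by rewrite gtr0_norm; lra.
have nu1 : dotp nu nu = 1 by exact: mesh_unit.
move: a b c; rewrite addrAC subrr add0r !dotpZr nu1 mulr1.
have e20 : 0 < e / 2 by lra.
move=> /(_ e20)[nk Ij] b c.
have [d0|d0|d0] := ltgtP (dotp nu' nu) 0.
- by apply: nk; apply: interior_subset; apply: b; nra.
- have [|_ Ij'] := c; first by nra.
  by have : (interior (cell T j) `&` interior (cell T j')) (x + (e / 2) *: nu)
    by []; rewrite mesh_disjoint.
- have kk : k \in k :: nbr T k by rewrite mem_head.
  have := cop _ _ _ _ kk j'k xj' kk jk xj nu d0; rewrite nu1 => /eqP.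
  by rewrite oner_eq0.
Qed.

End mesh_faces.

(** * Crossings of a cell along a line *)

Lemma exists_gap (R : realType) (I : eqType) (js : seq I) (pos : I -> R) (c : R) :
  (forall j, j \in js -> c < pos j) ->
  exists2 d : R, 0 < d & forall j, j \in js -> c + d < pos j.
Proof.
elim: js => [|j js IH] h; first by exists 1.
have [|d d0 dP] := IH; first by move=> i ijs; apply: h; rewrite in_cons ijs orbT.
have cj : c < pos j by apply: h; rewrite mem_head.
exists (Num.min d ((pos j - c) / 2)); first by rewrite lt_min d0; lra.
have m1 : Num.min d ((pos j - c) / 2) <= d by rewrite ge_min lexx.
have m2 : Num.min d ((pos j - c) / 2) <= (pos j - c) / 2 by rewrite ge_min lexx orbT.
by move=> i; rewrite in_cons => /orP[/eqP->|/dP]; lra.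
Qed.

(** The function [f] is constant between the positions, drops by [sg j] at [pos j] and vanishes far
    away on both sides, so the drops telescope. *)
Lemma sum_jumps (R : realType) (I : eqType) (js : seq I) (pos sg : I -> R)
    (f : R -> R) (M : R) :
  uniq js -> {in js &, injective pos} ->
  (forall a b, a <= b -> (forall j, j \in js -> ~ (a <= pos j <= b)) -> f a = f b) ->
  (forall j, j \in js -> exists2 e : R, 0 < e &
     forall t, 0 < t < e -> f (pos j - t) - f (pos j + t) = sg j) ->
  (forall s, M < `|s| -> f s = 0) ->
  \sum_(j <- js) sg j = 0.
Proof.
pose r := [rel i j | pos i <= pos j].
have rtr : transitive r by move=> y x z /=; exact: le_trans.
have rtot : total r by move=> x y /=; exact: le_total.
rewrite -(perm_big _ (introT permPl (perm_sort r js)))/=.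
have : sorted r (sort r js) by exact: sort_sorted.
rewrite -(sort_uniq r).
have memS : sort r js =i js by move=> i; rewrite mem_sort.
move: (sort r js) memS => js' memS js's js'u pinj fc fj fM.
have {}pinj : {in js' &, injective pos} by move=> i j; rewrite !memS; exact: pinj.
have {}fj j : j \in js' -> exists2 e : R, 0 < e &
     forall t, 0 < t < e -> f (pos j - t) - f (pos j + t) = sg j.
  by rewrite memS; exact: fj.
have {memS}fc a b : a <= b -> (forall j, j \in js' -> ~ (a <= pos j <= b)) -> f a = f b.
  by move=> ab h; apply: fc => // j; rewrite -memS; exact: h.
have [a aM] : exists a, (forall j, j \in js' -> a < pos j) /\ f a = 0.
  have [N NP] : exists N, forall j, j \in js' -> N < pos j.
    elim: js' {js's js'u pinj fj fc} => [|j js' [N NP]]; first by exists 0.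
    exists (Num.min N (pos j - 1)) => i; rewrite in_cons => /orP[/eqP->|/NP].
      by rewrite gt_min; apply/orP; right; lra.
    by rewrite gt_min => ->.
  exists (- (`|N| + `|M| + 1)); split=> [j /NP|].
    by have := ler_norm (- N); have := normr_ge0 M; rewrite normrN; lra.
  apply: fM; rewrite normrN ger0_norm; last first.
    by have := normr_ge0 N; have := normr_ge0 M; lra.
  by have := ler_norm M; have := normr_ge0 N; lra.
(* The claim becomes that the drops to the right of [a] add up to [f a]; the induction on the sorted
   list moves [a] past the first position. *)
case: aM => aj fa; rewrite -[RHS]fa.
have {}fc b c : a <= b -> b <= c -> (forall j, j \in js' -> ~ (b <= pos j <= c)) ->
  f b = f c by move=> _; exact: fc.
elim: js' a js's js'u pinj fj fc aj {fa} => [|j js' IH] a srt unq pinj fj fc aj.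
  rewrite big_nil -(fM (Num.max a 0 + `|M| + 1)).
    symmetry; apply: fc => //; have : a <= Num.max a 0 by rewrite le_max lexx.
    by have := normr_ge0 M; lra.
  have m0 : 0 <= Num.max a 0 by rewrite le_max lexx orbT.
  have := normr_ge0 M; have := ler_norm M => *.
  by rewrite ger0_norm; lra.
rewrite big_cons.
have lt_pos i : i \in js' -> pos j < pos i.
  move=> ijs; rewrite lt_neqAle; apply/andP; split; last first.
    by have /allP/(_ i ijs) := order_path_min rtr srt.
  apply/eqP => /pinj; rewrite mem_head in_cons ijs orbT => /(_ isT isT) ji.
  by move: unq; rewrite /= ji ijs.
have [d d0 dP] := exists_gap lt_pos.
have aj0 : a < pos j by apply: aj; rewrite mem_head.
have [e e0 eP] := fj j (mem_head _ _).
(* So small that [pos j + t] is left of the next position, [pos j - t] is right of [a], and the drop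
   at [pos j] is known. *)
pose t := Num.min (Num.min d e) (pos j - a) / 2.
have m0 : 0 < Num.min (Num.min d e) (pos j - a) by rewrite !lt_min d0 e0 subr_gt0.
have t0 : 0 < t by rewrite divr_gt0.
have td : t < d.
  have : Num.min (Num.min d e) (pos j - a) <= d by rewrite !ge_min lexx.
  by rewrite /t; lra.
have te : t < e.
  have : Num.min (Num.min d e) (pos j - a) <= e by rewrite !ge_min lexx !orbT.
  by rewrite /t; lra.
have ta : t < pos j - a.
  have : Num.min (Num.min d e) (pos j - a) <= pos j - a by rewrite !ge_min lexx !orbT.
  by rewrite /t; lra.
have jmp : f (pos j - t) - f (pos j + t) = sg j by apply: eP; rewrite t0.
rewrite (IH (pos j + t)).
- have -> : f a = f (pos j - t); last by rewrite -jmp; lra.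
  apply: fc => [||i]; [by []|by lra|].
  rewrite in_cons => /orP[/eqP->|/lt_pos]; last by lra.
  by lra.
- exact: path_sorted srt.
- by case/andP: unq.
- by move=> x y xs ys; apply: pinj; rewrite in_cons ?xs ?ys orbT.
- by move=> i ijs; apply: fj; rewrite in_cons ijs orbT.
- move=> b c jb bc h; apply: fc => //; first by lra.
  move=> i; rewrite in_cons => /orP[/eqP->|/h//]; lra.
- by move=> i /dP; lra.
Qed.

Section vertical_lines.
Context {R : realType}.
Implicit Types (x mu : 'rV[R]_3) (y : R * R) (s : R) (i : 'I_3).

(* The point of the line above [y] in the direction of the axis [i] whose
   [i]-th coordinate is [s]. *)
Definition line_point i y s : 'rV[R]_3 :=
  s *: delta_mx 0 i + (y.1 *: delta_mx 0 (lift i 0) + y.2 *: delta_mx 0 (lift i 1)).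

Lemma dotp_delta mu i : dotp mu (delta_mx 0 i) = mu 0 i.
Proof.
rewrite /dotp mxE (bigD1 i)//= !mxE !eqxx mulr1 big1 ?addr0// => j ji.
by rewrite !mxE eqxx/= (negPf ji) mulr0.
Qed.

Lemma dotp_line_point mu i y s : dotp mu (line_point i y s) =
  s * mu 0 i + (y.1 * mu 0 (lift i 0) + y.2 * mu 0 (lift i 1)).
Proof. by rewrite !dotpDr !dotpZr !dotp_delta. Qed.

Lemma line_pointD i y s t : line_point i y (s + t) = line_point i y s + t *: delta_mx 0 i.
Proof. by rewrite /line_point scalerDl addrAC. Qed.

Lemma line_point_coord i y s : line_point i y s 0 i = s.
Proof.
rewrite /line_point !mxE !eqxx/= !(negPf (neq_lift _ _)).
by rewrite !mulr0 !addr0 mulr1.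
Qed.

Lemma ord3_cases i (j : 'I_3) : [\/ j = i, j = lift i 0 | j = lift i 1].
Proof.
case: (unliftP i j) => [[[|[|//]] h] ->|->]; last by apply: Or31.
- by apply: Or32; congr lift; exact/val_inj.
- by apply: Or33; congr lift; exact/val_inj.
Qed.

Lemma line_pointK i x : line_point i (x 0 (lift i 0), x 0 (lift i 1)) (x 0 i) = x.
Proof.
apply/rowP => j; rewrite /line_point !mxE !eqxx/=.
have l01 : (lift i 0 == lift i 1) = false by rewrite (inj_eq lift_inj).
have l10 : (lift i 1 == lift i 0) = false by rewrite (inj_eq lift_inj).
have li n : (lift i n == i) = false by rewrite eq_sym (negPf (neq_lift _ _)).
have il n : (i == lift i n) = false by rewrite (negPf (neq_lift _ _)).
by case: (ord3_cases i j) => ->; rewrite ?eqxx ?l01 ?l10 ?li ?il/= ?(mulr0, mulr1, addr0, add0r).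
Qed.

Lemma line_point_continuous i (g : R * R -> R) : continuous g ->
  continuous (fun y => line_point i y (g y)).
Proof.
move=> cg y; apply: cvgD; first by apply: cvgZr_tmp; exact: cg.
by apply: cvgD; apply: cvgZr_tmp; [exact: cvg_fst|exact: cvg_snd].
Qed.

End vertical_lines.

Section face_crossings.
Context {R : realType} (X : set 'rV[R]_3) (K : eqType) (T : mesh X K).
Variables (k : K) (i : 'I_3).
Implicit Types (j l : K) (x mu : 'rV[R]_3) (y : R * R) (s : R).

Local Notation nu := (unit_normal T).

(** The constant term of the plane of the face, read off at a chosen point; the default 0 is taken
    only for an empty face. *)
Definition face_level k1 j := dotp (nu k1 j) (xget 0 (face T k1 j)).

Lemma face_levelE k1 j x : j \in nbr T k1 -> face T k1 j x ->
  dotp (nu k1 j) x = face_level k1 j.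
Proof.
move=> jk xF; have oF : face T k1 j (xget 0 (face T k1 j)) by apply: xgetPex; exists x.
by have := mesh_flat jk oF xF; rewrite dotpDr dotpNr => /eqP; rewrite subr_eq0 => /eqP.
Qed.

Definition local_faces := [seq (k1, l) | k1 <- k :: nbr T k, l <- nbr T k1].

Lemma local_facesP k1 l : k1 \in k :: nbr T k -> l \in nbr T k1 -> (k1, l) \in local_faces.
Proof. by move=> k1k lk1; apply/allpairsPdep; exists k1, l. Qed.

(* The planes parallel to the axis [i] which contain a face parallel to the axis,
   or the intersection of the planes of two faces. *)
Definition vertical_planes : seq ('rV[R]_3 * R) :=
  [seq (nu p.1 p.2, face_level p.1 p.2) | p <- local_faces] ++
  [seq (nu q.1 q.2 0 i *: nu p.1 p.2 - nu p.1 p.2 0 i *: nu q.1 q.2,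
        nu q.1 q.2 0 i * face_level p.1 p.2 - nu p.1 p.2 0 i * face_level q.1 q.2)
   | p <- local_faces, q <- local_faces].

(** The condition [m.1 != 0] discards pairs of faces with parallel normals, whose combination is
    zero and defines no plane. *)
Definition generic y := forall m, m \in vertical_planes -> m.1 != 0 ->
  m.1 0 i = 0 -> dotp m.1 (line_point i y 0) <> m.2.

Lemma dotp_vertical mu y s : mu 0 i = 0 ->
  dotp mu (line_point i y s) = dotp mu (line_point i y 0).
Proof. by move=> mu0; rewrite !dotp_line_point mu0 !mulr0. Qed.

Lemma unit_normal_neq0 k1 l : l \in nbr T k1 -> nu k1 l != 0.
Proof.
move=> lk1; apply: contra_eq_neq (mesh_unit lk1) => ->.
by rewrite dotpE !mxE !mul0r !addr0 eq_sym oner_eq0.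
Qed.

Lemma generic_transversal y s k1 l : generic y -> k1 \in k :: nbr T k -> l \in nbr T k1 ->
  face T k1 l (line_point i y s) -> nu k1 l 0 i != 0.
Proof.
move=> gy k1k lk1 xF; apply/eqP => nu0.
apply: (gy (nu k1 l, face_level k1 l)); rewrite /= ?unit_normal_neq0//.
  rewrite mem_cat; apply/orP; left; apply/mapP; exists (k1, l) => //.
  exact: local_facesP.
by rewrite -(dotp_vertical y s nu0); exact: face_levelE.
Qed.

(** The combination [mu] of the two normals has no component along the axis. If it were nonzero, the
    line would lie in one of the [vertical_planes]; hence the normals are proportional. *)
Lemma generic_coplanar y s : generic y -> coplanar_faces_at T k (line_point i y s).
Proof.
move=> gy k1 l1 k2 l2 k1k l1k1 x1 k2k l2k2 x2 z z0.
have n1 := generic_transversal gy k1k l1k1 x1.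
have n2 := generic_transversal gy k2k l2k2 x2.
pose mu := nu k2 l2 0 i *: nu k1 l1 - nu k1 l1 0 i *: nu k2 l2.
have mui : mu 0 i = 0 by rewrite !mxE mulrC subrr.
have dmu x : dotp mu x = nu k2 l2 0 i * dotp (nu k1 l1) x - nu k1 l1 0 i * dotp (nu k2 l2) x.
  by rewrite !dotpE !mxE; ring.
have [mu0|mu0] := eqVneq mu 0.
  have : dotp mu z = 0 by rewrite mu0 dotpE !mxE; ring.
  rewrite dmu z0 mulr0 sub0r => /eqP; rewrite oppr_eq0 mulf_eq0 (negPf n1).
  by move=> /eqP.
exfalso; apply: (gy (mu, nu k2 l2 0 i * face_level k1 l1 - nu k1 l1 0 i * face_level k2 l2));
  rewrite //=.
  rewrite mem_cat; apply/orP; right; apply/allpairsP.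
  by exists ((k1, l1), (k2, l2)); split; rewrite ?local_facesP.
by rewrite -(dotp_vertical y s mui) dmu (face_levelE l1k1 x1) (face_levelE l2k2 x2).
Qed.

Definition crossing j y := (face_level k j - dotp (nu k j) (line_point i y 0)) / nu k j 0 i.

Lemma crossingE j y s : j \in nbr T k -> nu k j 0 i != 0 ->
  face T k j (line_point i y s) -> s = crossing j y.
Proof.
move=> jk n0 /(face_levelE jk); rewrite /crossing => <-.
by rewrite !dotp_line_point mul0r add0r addrK mulfK.
Qed.

(** For a face transversal to the axis [i], its projection along this axis. *)
Definition shadow j : set (R * R) := [set y | face T k j (line_point i y (crossing j y))].

(** This is [sum_jumps] for the indicator of the cell along the line above [y]: it drops from 1 to 0
    where the line leaves through a face with [nu k j 0 i > 0], and rises where the sign is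
    negative. *)
Lemma sum_crossing_signs y : generic y ->
  \sum_(j <- nbr T k | nu k j 0 i != 0) Num.sg (nu k j 0 i) * \1_(shadow j) y = 0 :> R.
Proof.
move=> gy.
pose js := [seq j <- nbr T k | (nu k j 0 i != 0) && (y \in shadow j)].
transitivity (\sum_(j <- js) Num.sg (nu k j 0 i)).
  rewrite big_filter big_mkcondr/=; apply: eq_bigr => j _.
  by rewrite indicE; case: ifP => _; rewrite ?mulr1 ?mulr0.
have jsP j : j \in js -> [/\ j \in nbr T k, nu k j 0 i != 0 &
    face T k j (line_point i y (crossing j y))].
  by rewrite mem_filter => /andP[/andP[n0]]; rewrite inE => yj jk.
have js_in j s : j \in nbr T k -> face T k j (line_point i y s) ->
    s = crossing j y /\ j \in js.
  move=> jk xF; have n0 := generic_transversal gy (mem_head _ _) jk xF.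
  have sE := crossingE jk n0 xF; split => //.
  by rewrite mem_filter jk n0 /= andbT inE /shadow/= -sE.
have bounded : exists M, forall s, M < `|s| -> ~ cell T k (line_point i y s).
  have : compact ((fun x : 'rV[R]_3 => x 0 i) @` cell T k).
    apply: continuous_compact; last exact: mesh_compact.
    by apply: continuous_subspaceT => x; exact: coord_continuous.
  move=> /compact_bounded[M [_ MP]]; exists (M + 1) => s sM cs.
  have : `|s| <= M + 1.
    by apply: MP; [lra|exists (line_point i y s) => //; exact: line_point_coord].
  by lra.
case: bounded => M MP.
(* A piece of the line without crossings avoids the boundary, so it stays in the cell. *)
have seg a b : (forall j, j \in js -> forall t, 0 <= t <= 1 ->
    a + t * (b - a) <> crossing j y) -> cell T k (line_point i y a) ->
    cell T k (line_point i y b).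
  move=> h ca; apply: (segment_interior (@cell_closed _ _ _ T k) ca) => t t01.
  have -> : line_point i y a + t *: (line_point i y b - line_point i y a) =
      line_point i y (a + t * (b - a)).
    by apply/rowP => j; rewrite !mxE; ring.
  rewrite -(mesh_boundary T k) => -[j /= jk /(js_in j _ jk)[+ jjs]].
  exact: h.
pose f s : R := \1_(cell T k) (line_point i y s).
apply: (@sum_jumps _ _ js (crossing^~ y) _ f M).
- by rewrite filter_uniq ?mesh_nbr_uniq.
- move=> j j' /jsP[jk n0 xj] /jsP[j'k n0' xj'] ejj'.
  rewrite -/(crossing j y) -/(crossing j' y) in ejj'; rewrite -ejj' in xj'.
  by apply: (face_unique jk j'k xj xj'); exact: generic_coplanar.
- move=> a b ab h; rewrite /f !indicE; congr (nat_of_bool _)%:R.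
  apply/idP/idP; rewrite !inE; apply: seg => j jjs t /andP[t0 t1] E;
  by apply: (h j jjs); rewrite -E; nra.
- move=> j /jsP[jk n0 xj].
  have [e e0 eP] := nbhs_step (delta_mx 0 i) (near_face jk xj (generic_coplanar gy)).
  exists e => // t /andP[t0 te].
  have tn : `|t| < e by rewrite gtr0_norm.
  have tn' : `|- t| < e by rewrite normrN.
  have dE u : dotp (nu k j) (line_point i y (crossing j y) + u *: delta_mx 0 i -
      line_point i y (crossing j y)) = u * nu k j 0 i.
    by rewrite addrAC subrr add0r dotpZr dotp_delta.
  have [a1 a2] := eP _ tn; have [b1 b2] := eP _ tn'.
  rewrite /f !line_pointD !indicE.
  move: a1 a2 b1 b2; rewrite !dE.
  have [nlt|ngt|neq] := ltgtP (nu k j 0 i) 0; last by rewrite neq eqxx in n0.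
  + move=> a1 _ _ b2; have [|nA _] := b2; first by nra.
    have Ai : cell T k (line_point i y (crossing j y) + t *: delta_mx 0 i).
      by apply: interior_subset; apply: a1; nra.
    by rewrite ltr0_sg// (memNset nA) (mem_set Ai) sub0r.
  + move=> _ a2 b1 _; have [|nA _] := a2; first by nra.
    have Ai : cell T k (line_point i y (crossing j y) + (- t) *: delta_mx 0 i).
      by apply: interior_subset; apply: b1; nra.
    by rewrite gtr0_sg// (memNset nA) (mem_set Ai) subr0.
- by move=> s /MP cs; rewrite /f indicE memNset.
Qed.

End face_crossings.

(** * The closed surface identity *)

(** The minor is, up to sign, the [i]-th coordinate of the cross product of [u] and [w]. It is the
    Jacobian of the projection along the axis [i], in the frame [u], [w] of the plane orthogonal to
    [n]. *)
Lemma orthonormal_minor (R : realType) (u w n : 'rV[R]_3) (i : 'I_3) :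
  dotp u u = 1 -> dotp w w = 1 -> dotp n n = 1 ->
  dotp u w = 0 -> dotp u n = 0 -> dotp w n = 0 ->
  `|u 0 (lift i 0) * w 0 (lift i 1) - w 0 (lift i 0) * u 0 (lift i 1)| = `|n 0 i|.
Proof.
rewrite !dotpE => uu ww nn uw un wn.
suff /eqP : (u 0 (lift i 0) * w 0 (lift i 1) - w 0 (lift i 0) * u 0 (lift i 1)) ^+ 2 = n 0 i ^+ 2.
  by rewrite eqf_sqr => /orP[]/eqP->; rewrite ?normrN.
set u0 := u 0 0 in uu uw un *; set u1 := u 0 1 in uu uw un *; set u2 := u 0 2 in uu uw un *.
set w0 := w 0 0 in ww uw wn *; set w1 := w 0 1 in ww uw wn *; set w2 := w 0 2 in ww uw wn *.
set n0 := n 0 0 in nn un wn *; set n1 := n 0 1 in nn un wn *; set n2 := n 0 2 in nn un wn *.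
(* [c] is the cross product of [u] and [w]; it is a unit vector, and
   [n * (u * w) = (n . w) u - (n . u) w = 0] makes it parallel to [n]. *)
pose c0 := u1 * w2 - u2 * w1; pose c1 := u2 * w0 - u0 * w2; pose c2 := u0 * w1 - u1 * w0.
have cc : c0 * c0 + c1 * c1 + c2 * c2 = 1.
  have -> : c0 * c0 + c1 * c1 + c2 * c2 = (u0 * u0 + u1 * u1 + u2 * u2) *
    (w0 * w0 + w1 * w1 + w2 * w2) - (u0 * w0 + u1 * w1 + u2 * w2) ^+ 2.
    by rewrite /c0 /c1 /c2; ring.
  by rewrite uu ww uw; ring.
pose a := n0 * c0 + n1 * c1 + n2 * c2.
pose nw := w0 * n0 + w1 * n1 + w2 * n2; pose nu := u0 * n0 + u1 * n1 + u2 * n2.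
have E0 : c0 = a * n0.
  transitivity (c0 * (n0 * n0 + n1 * n1 + n2 * n2)); first by rewrite nn mulr1.
  transitivity (a * n0 + n2 * (u1 * nw - w1 * nu) - n1 * (u2 * nw - w2 * nu)).
    by rewrite /a /nw /nu /c0 /c1 /c2; ring.
  by rewrite /nw /nu un wn; ring.
have E1 : c1 = a * n1.
  transitivity (c1 * (n0 * n0 + n1 * n1 + n2 * n2)); first by rewrite nn mulr1.
  transitivity (a * n1 + n0 * (u2 * nw - w2 * nu) - n2 * (u0 * nw - w0 * nu)).
    by rewrite /a /nw /nu /c0 /c1 /c2; ring.
  by rewrite /nw /nu un wn; ring.
have E2 : c2 = a * n2.
  transitivity (c2 * (n0 * n0 + n1 * n1 + n2 * n2)); first by rewrite nn mulr1.
  transitivity (a * n2 + n1 * (u0 * nw - w0 * nu) - n0 * (u1 * nw - w1 * nu)).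
    by rewrite /a /nw /nu /c0 /c1 /c2; ring.
  by rewrite /nw /nu un wn; ring.
have a2 : a ^+ 2 = 1.
  rewrite -cc E0 E1 E2; transitivity (a ^+ 2 * (n0 * n0 + n1 * n1 + n2 * n2)).
    by rewrite nn mulr1.
  by ring.
have liftE (m : nat) (h : (m < 3)%N) (p q : 'I_2) :
    lift (Ordinal h) p = inord (bump m p) :> 'I_3.
  by apply: val_inj; rewrite /= inordK//; case: p => [[|[|]]]//=; case: m h => [|[|[|]]].
have i0 : inord 0 = 0 :> 'I_3 by apply: val_inj; rewrite /= inordK.
have i1 : inord 1 = 1 :> 'I_3 by apply: val_inj; rewrite /= inordK.
have i2 : inord 2 = 2 :> 'I_3 by apply: val_inj; rewrite /= inordK.
case: i => [[|[|[|//]]] h]; rewrite !(liftE _ _ _ 0)/= ?i0 ?i1 ?i2.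
- have -> : Ordinal h = 0 :> 'I_3 by exact: val_inj.
  by rewrite -[RHS]mul1r -a2 -exprMn -E0 /c0 /u1 /u2 /w1 /w2; ring.
- have -> : Ordinal h = 1 :> 'I_3 by exact: val_inj.
  rewrite -[RHS]mul1r -a2 -exprMn -E1 /c1 /u0 /u2 /w0 /w2; ring.
- have -> : Ordinal h = 2 :> 'I_3 by exact: val_inj.
  by rewrite -[RHS]mul1r -a2 -exprMn -E2 /c2 /u0 /u1 /w0 /w1; ring.
Qed.

Section closed_surface.
Context {R : realType} (X : set 'rV[R]_3) (K : eqType) (T : mesh X K).
Variables (k : K) (i : 'I_3).
Implicit Types (j l : K) (x mu : 'rV[R]_3) (y : R * R).

Local Notation nu := (unit_normal T).
Local Notation lam := (@lebesgue_measure R).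
Local Notation lam2 := (lam \x lam)%E.

Lemma crossing_continuous j : continuous (crossing T k i j).
Proof.
have -> : crossing T k i j = fun y : R * R => (face_level T k j -
    (y.1 * nu k j 0 (lift i 0) + y.2 * nu k j 0 (lift i 1))) * (nu k j 0 i)^-1.
  by apply/funext => y; rewrite /crossing dotp_line_point mul0r add0r.
move=> y; apply: cvgM; last exact: cvg_cst.
apply: cvgB; first exact: cvg_cst.
by apply: cvgD; apply: cvgM; try exact: cvg_cst; [exact: cvg_fst|exact: cvg_snd].
Qed.

Lemma measurable_shadow j : measurable (shadow T k i j).
Proof.
apply: closed_measurable2; apply: closed_comp.
  by move=> y _; apply: line_point_continuous; exact: crossing_continuous.
by apply: closedI; exact: closed_boundary.
Qed.

(** The excluded points lie on finitely many lines of the plane, each of measure zero. *)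
Lemma generic_ae : {ae lam2, forall y, generic T k i y}.
Proof.
apply: (@near_all_in _ (almost_everywhere lam2)) => -[mu d] /= _.
have [mu0|mu0] := eqVneq mu 0; first exact: aeW.
have [mui|/eqP mui] := eqVneq (mu 0 i) 0; last exact: aeW.
have coef : (mu 0 (lift i 0) != 0) || (mu 0 (lift i 1) != 0).
  rewrite -negb_and; apply: contra mu0 => /andP[/eqP a /eqP b].
  by apply/eqP/rowP => j; rewrite !mxE; case: (ord3_cases i j) => ->.
have mL : measurable [set y : R * R | mu 0 (lift i 0) * y.1 + mu 0 (lift i 1) * y.2 = d].
  have mf : measurable_fun setT (fun z : R * R => mu 0 (lift i 0) * z.1 + mu 0 (lift i 1) * z.2).
    apply: measurable_funD; apply: measurable_funM => //;
      first [exact: measurable_fst | exact: measurable_snd].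
  rewrite -[X in measurable X]setTI.
  exact: (mf measurableT [set d] (measurable_set1 d)).
have := (negligibleP lam2 mL).2 (lebesgue2_line d coef).
apply: negligibleS => y /= /not_implyP[_] /not_implyP[_] /contrapT.
by rewrite dotp_line_point mul0r add0r => <-; rewrite ![_ * mu _ _]mulrC.
Qed.

(** The frame coordinates that define the area are carried to the shadow by an affine map with
    determinant [nu k j 0 i] up to sign. *)
Lemma lebesgue2_shadow j : j \in nbr T k -> nu k j 0 i != 0 ->
  lam2 (shadow T k i j) = (`|nu k j 0 i| * areaE T k j)%:E.
Proof.
move=> jk n0; have := mesh_face jk; rewrite /areaE /area /plane_frame.
(* Without a frame, the default one would make the set empty or the whole plane. Its area would be 0
   in both cases, since [fine] sends infinity to 0, against [mesh_face]. *)
set P := (X in xget _ X); have [[f0 Pf0]|noP] := pselect (exists f, P f); last first.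
  rewrite xgetPN => [|f Pf]; last by apply: noP; exists f.
  have -> : [set z : R * R | face T k j (0 + z.1 *: 0 + z.2 *: 0)] =
      [set _ | face T k j 0].
    by apply: eq_set => z; rewrite !scaler0 !addr0.
  have [F0|F0] := pselect (face T k j 0).
    have -> : [set _ : R * R | face T k j 0] = setT `*` setT.
      by rewrite setXTT; apply/funext => z; apply/propext.
    by rewrite product_measure1E//= -set_itvNyy lebesgue_measure_itv/= ltxx.
  have -> : [set _ : R * R | face T k j 0] = set0.
    by apply/funext => z; apply/propext.
  by rewrite measure0 ltxx.
have := xgetPex (0, 0, 0) (ex_intro _ f0 Pf0).
move: (xget _ P) => [[b u] w] /= [Fb [uu ww uw un wn]].
pose D := u 0 (lift i 0) * w 0 (lift i 1) - w 0 (lift i 0) * u 0 (lift i 1).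
have absD : `|D| = `|nu k j 0 i|.
  by apply: orthonormal_minor => //; exact: mesh_unit.
have D0 : D != 0 by rewrite -normr_eq0 absD normr_eq0.
have -> : [set z : R * R | face T k j (b + z.1 *: u + z.2 *: w)] =
  [set z | shadow T k i j (u 0 (lift i 0) * z.1 + w 0 (lift i 0) * z.2 + b 0 (lift i 0),
                           u 0 (lift i 1) * z.1 + w 0 (lift i 1) * z.2 + b 0 (lift i 1))].
  apply/eq_set => z; set x := b + z.1 *: u + z.2 *: w.
  have -> : (u 0 (lift i 0) * z.1 + w 0 (lift i 0) * z.2 + b 0 (lift i 0),
             u 0 (lift i 1) * z.1 + w 0 (lift i 1) * z.2 + b 0 (lift i 1)) =
            (x 0 (lift i 0), x 0 (lift i 1)).
    by rewrite /x !mxE; congr (_, _); ring.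
  have xP : dotp (nu k j) x = face_level T k j.
    rewrite -(face_levelE jk Fb) !dotpDr !dotpZr.
    have -> : dotp (nu k j) u = 0 by rewrite -un !dotpE; ring.
    have -> : dotp (nu k j) w = 0 by rewrite -wn !dotpE; ring.
    by rewrite !mulr0 !addr0.
  rewrite /shadow /=; congr (face T k j _); rewrite -[LHS](line_pointK i).
  congr line_point; rewrite /crossing -xP -[in dotp (nu k j) x](line_pointK i x).
  by rewrite !dotp_line_point mul0r add0r addrK mulfK.
rewrite [X in fine X](lebesgue2_affine _ _ D0 (measurable_shadow j)) absD.
(* A shadow of infinite measure would likewise give the area 0. *)
have : (0 <= lam2 (shadow T k i j))%E by exact: measure_ge0.
move: (lam2 _) => [r _ _|_|//]; first by rewrite /= mulrA divff ?normr_eq0// mul1r.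
by rewrite gt0_muley ?lte_fin ?invr_gt0 ?normr_gt0//= ltxx.
Qed.

(** Splitting the faces by the sign of [nu k j 0 i] turns [sum_crossing_signs] into an equality
    almost everywhere of two nonnegative functions, whose integrals are therefore equal. *)
Lemma sum_area_normal_coord : \sum_(j <- nbr T k) areaE T k j * nu k j 0 i = 0.
Proof.
pose S j : set (R * R) := if nu k j 0 i == 0 then set0 else shadow T k i j.
have mS j : measurable (S j) by rewrite /S; case: ifP => // _; exact: measurable_shadow.
pose jp := [seq j <- nbr T k | 0 < nu k j 0 i].
pose jn := [seq j <- nbr T k | nu k j 0 i < 0].
pose F (js : seq K) y : \bar R := (\sum_(j <- js) (\1_(S j) y)%:E)%E.
have mF js : measurable_fun setT (F js).
  by apply: emeasurable_sum => j; apply/measurable_EFinP; exact: measurable_indic.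
have F0 js y : (0 <= F js y)%E by apply: sume_ge0 => j _; rewrite lee_fin.
have intF js : (\int[lam2]_y F js y = \sum_(j <- js) lam2 (S j))%E.
  rewrite ge0_integral_sum//.
  - apply: eq_bigr => j _; rewrite -[in RHS](setIT (S j)).
    by apply: integral_indic; [exact: measurableT|exact: mS].
  - move=> j; apply/measurable_EFinP; apply: measurable_indic; exact: mS.
have areaS j : j \in nbr T k -> nu k j 0 i != 0 ->
    lam2 (S j) = (`|nu k j 0 i| * areaE T k j)%:E.
  by move=> jk n0; rewrite /S (negPf n0); exact: lebesgue2_shadow.
have : (\int[lam2]_y F jp y = \int[lam2]_y F jn y)%E.
  apply: ge0_ae_eq_integral; [exact: measurableT|exact: mF|exact: mF|by []|by []|].
  apply: (@filterS _ (almost_everywhere lam2) _ _ _ _ generic_ae) => y gy _.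
  rewrite /F !sumEFin; congr (_%:E); apply/eqP; rewrite -subr_eq0.
  rewrite !big_filter !(big_mkcond (fun j => _ < _))/= -sumrB; apply/eqP.
  rewrite -[RHS](sum_crossing_signs gy) [RHS]big_mkcond/=.
  apply: eq_bigr => j _; rewrite /S; have [n0|n0|->] := ltgtP (nu k j 0 i) 0.
  + by rewrite sub0r ltr0_sg// mulN1r.
  + by rewrite subr0 gtr0_sg// mul1r.
  + by rewrite subrr.
have sumS (P : pred K) : (forall j, P j -> nu k j 0 i != 0) ->
    (\sum_(j <- nbr T k | P j) lam2 (S j) =
     (\sum_(j <- nbr T k | P j) `|nu k j 0 i| * areaE T k j)%:E)%E.
  move=> Pn; rewrite -sumEFin big_seq_cond [RHS]big_seq_cond.
  by apply: eq_bigr => j /andP[jk /Pn n0]; exact: areaS.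
rewrite !intF !big_filter !sumS => [|j|j]; [|by move/lt_eqF->|by move/gt_eqF->].
move=> [/eqP]; rewrite -subr_eq0 !(big_mkcond (fun j => _ < _))/= -sumrB => /eqP E.
rewrite -[RHS]E; apply: eq_bigr => j _.
have [n0|n0|->] := ltgtP (nu k j 0 i) 0; rewrite ?mulr0 ?subr0 ?sub0r//.
  by rewrite ltr0_norm// mulNr opprK mulrC.
by rewrite gtr0_norm// mulrC.
Qed.

End closed_surface.

Lemma sum_area_normal (R : realType) (X : set 'rV[R]_3) (K : eqType) (T : mesh X K) (k : K) :
  \sum_(j <- nbr T k) areaE T k j *: unit_normal T k j = 0.
Proof.
apply/rowP => i; rewrite summxE mxE -[RHS](sum_area_normal_coord T k i).
by apply: eq_bigr => j _; rewrite mxE.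
Qed.

(** * The cone of admissible states *)

Section cauchy_schwarz.
Context {R : rcfType} {I : finType} (P : pred I).
Implicit Types a b : I -> R.

Lemma sum_sqr_ge0 a : 0 <= \sum_(i | P i) a i ^+ 2.
Proof. by apply: sumr_ge0 => i _; exact: sqr_ge0. Qed.

Lemma cauchy_schwarz_sum a b :
  (\sum_(i | P i) a i * b i) ^+ 2 <=
  (\sum_(i | P i) a i ^+ 2) * (\sum_(i | P i) b i ^+ 2).
Proof.
set A := \sum_(i | P i) a i ^+ 2; set B := \sum_(i | P i) b i ^+ 2.
set C := \sum_(i | P i) a i * b i.
(* A nonnegative quadratic in [t], used at its minimum [t = C / B]; when [B = 0] all the [b i]
   vanish. *)
have quad (t : R) : A - 2 * t * C + t ^+ 2 * B = \sum_(i | P i) (a i - t * b i) ^+ 2.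
  rewrite /A /B /C !mulr_sumr -sumrB -big_split/=.
  by apply: eq_bigr => i _; ring.
have [B0|B0] := eqVneq B 0; last first.
  have B_gt0 : 0 < B by rewrite lt_neqAle eq_sym B0 sum_sqr_ge0.
  have := sum_sqr_ge0 (fun i => a i - C / B * b i); rewrite -quad.
  have -> : A - 2 * (C / B) * C + (C / B) ^+ 2 * B = (A * B - C ^+ 2) / B by field.
  by rewrite pmulr_lge0 ?invr_gt0// subr_ge0.
have -> : C = 0; last by rewrite B0 mulr0 expr0n.
apply: big1 => i Pi; have : b i ^+ 2 <= 0.
  by rewrite -B0 /B (bigD1 i)//= lerDl sumr_ge0// => j _; exact: sqr_ge0.
by move=> bi; have /eqP : b i ^+ 2 = 0 by [apply/le_anti; rewrite bi sqr_ge0];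
  rewrite sqrf_eq0 => /eqP ->; rewrite mulr0.
Qed.

Lemma minkowski_sum a b :
  Num.sqrt (\sum_(i | P i) (a i + b i) ^+ 2) <=
  Num.sqrt (\sum_(i | P i) a i ^+ 2) + Num.sqrt (\sum_(i | P i) b i ^+ 2).
Proof.
set A := \sum_(i | P i) a i ^+ 2; set B := \sum_(i | P i) b i ^+ 2.
pose C := \sum_(i | P i) a i * b i.
have A0 : 0 <= A by exact: sum_sqr_ge0.
have B0 : 0 <= B by exact: sum_sqr_ge0.
have CAB : C <= Num.sqrt A * Num.sqrt B.
  rewrite -sqrtrM// (le_trans (ler_norm _))// -sqrtr_sqr ler_wsqrtr//.
  exact: cauchy_schwarz_sum.
have -> : \sum_(i | P i) (a i + b i) ^+ 2 = A + 2 * C + B.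
  rewrite /A /B /C mulr_sumr -!big_split/=.
  by apply: eq_bigr => i _; ring.
rewrite -[leRHS]ger0_norm ?addr_ge0 ?sqrtr_ge0// -sqrtr_sqr ler_wsqrtr//.
rewrite sqrrD !sqr_sqrtr//; move: CAB; set D := _ * _; rewrite -mulr_natl; lra.
Qed.

End cauchy_schwarz.

Section cone.
Context {R : realType}.
Implicit Types W S : 'cV[R]_5.

(** Minkowski's inequality; together with [qfunZ] this is the concavity of [qfun]. *)
Lemma qfunD W S : qfun W + qfun S <= qfun (W + S).
Proof.
rewrite /qfun mxE addrACA -opprD lerD2l lerN2.
under eq_bigr do rewrite mxE.
exact: minkowski_sum.
Qed.

Lemma qfunZ (c : R) W : 0 <= c -> qfun (c *: W) = c * qfun W.
Proof.
move=> c0; rewrite /qfun mxE mulrBr; congr (_ - _).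
under eq_bigr do rewrite mxE exprMn.
by rewrite -mulr_sumr sqrtrM ?sqr_ge0// sqrtr_sqr ger0_norm.
Qed.

(** Intermediate value theorem for [t = l^-1]. This shows that [lambdaS] is a genuine root whenever
    [qfun S < 0]. *)
Lemma lambdaS_root W S : 0 < qfun W -> qfun S < 0 ->
  exists2 l : R, 0 < l & qfun (W + l^-1 *: S) = 0.
Proof.
move=> qW qS.
pose f (t : R) := qfun (W + t *: S).
have cf : continuous f.
  have -> : f = fun t => (W ord_max 0 + t * S ord_max 0) -
      Num.sqrt (\sum_(i < 5 | (i < 4)%N) W i 0 ^+ 2 +
        t * (2 * \sum_(i < 5 | (i < 4)%N) W i 0 * S i 0) +
        t ^+ 2 * \sum_(i < 5 | (i < 4)%N) S i 0 ^+ 2).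
    apply/funext => t; rewrite /f /qfun !mxE; congr (_ - Num.sqrt _).
    rewrite !mulr_sumr -!big_split/=; apply: eq_bigr => i _; rewrite !mxE; ring.
  move=> t; apply: cvgB.
    by apply: cvgD; [exact: cvg_cst|apply: cvgM; [exact: cvg_id|exact: cvg_cst]].
  apply: (cvg_comp _ Num.sqrt _ (@sqrt_continuous R _)).
  apply: cvgD; last by apply: cvgM; [exact: exprn_continuous|exact: cvg_cst].
  by apply: cvgD; [exact: cvg_cst|apply: cvgM; [exact: cvg_id|exact: cvg_cst]].
(* Chosen so that [b * qfun S < qfun (- W)] in the sense of [qfunD]: from [f b + qfun (- W) <= b *
   qfun S = - |qfun (- W)| - 1] follows [f b < 0]. *)
pose b := (`|qfun (- W)| + 1) / - qfun S.
have nqS : 0 < - qfun S by rewrite oppr_gt0.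
have b0 : 0 < b by rewrite divr_gt0// ltr_wpDl.
have fb : f b < 0.
  have := qfunD (W + b *: S) (- W).
  have -> : W + b *: S - W = b *: S by rewrite addrAC subrr add0r.
  rewrite (qfunZ _ (ltW b0)).
  have -> : b * qfun S = - (`|qfun (- W)| + 1) by rewrite /b; field; rewrite lt_eqF.
  by have := ler_norm (- qfun (- W)); rewrite normrN -/(f b); lra.
have f0 : f 0 = qfun W by rewrite /f scale0r addr0.
have [||t] := @IVT _ f 0 b 0 (ltW b0).
- exact: continuous_subspaceT.
- by rewrite f0 ge_min le_max (ltW fb) (ltW qW) orbT.
rewrite in_itv/= => /andP[t0 _] ft; exists t^-1; last by rewrite invrK.
rewrite invr_gt0 lt_neqAle t0 andbT; apply/eqP => t00.
by move: ft; rewrite -t00 f0 => q0; move: qW; rewrite q0 ltxx.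
Qed.

Lemma lambdaS_ge0 W S : 0 <= lambdaS W S.
Proof.
rewrite /lambdaS; case: ifP => // _; set P := (X in xget _ X).
have [[l Pl]|noP] := pselect (exists l, P l).
  by have [/ltW] := xgetPex 0 (ex_intro _ l Pl).
by rewrite xgetPN// => l Pl; apply: noP; exists l.
Qed.

(** With [l] the root, [th W + d S = (th - d l) W + d l (W + S / l)], where [qfun] is positive on
    the first term and zero on the second. *)
Lemma qfun_lambdaS W S (th d : R) : 0 < qfun W -> 0 < d -> d * lambdaS W S < th ->
  0 < qfun (th *: W + d *: S).
Proof.
move=> qW d0; rewrite /lambdaS; case: ifPn => [qS|].
  rewrite mulr0 => th0; apply: lt_le_trans (qfunD _ _).
  by rewrite !qfunZ 1?ltW// ltr_wpDr ?mulr_gt0// mulr_ge0// ltW.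
rewrite -ltNge => qS; set P := (X in xget _ X).
have [l l0 ql] := lambdaS_root qW qS.
have : P (xget 0 P) by apply: xgetPex; exists l.
move: (xget 0 P) => {l l0 ql} l [l0 ql] dl.
have -> : th *: W + d *: S = (th - d * l) *: W + (d * l) *: (W + l^-1 *: S).
  by rewrite scalerDr scalerA addrA -scalerDl subrK mulfK ?gt_eqF.
apply: lt_le_trans (qfunD _ _).
rewrite qfunZ ?subr_ge0 1?ltW// qfunZ ?mulr_ge0 1?ltW// ql mulr0 addr0.
by rewrite mulr_gt0// subr_gt0.
Qed.

End cone.

(** * Recovery of the primitive variables *)

Section equation_of_state.
Context {R : realType} (e : R -> R -> R) (he : is_eos e).
Implicit Types p rho : R.

Lemma derivable_enth_rho p rho : 0 < p -> 0 < rho -> derivable (enth e p) rho 1.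
Proof.
move=> p0 r0; apply: derivableD.
  by apply: derivableD; [exact: derivable_cst|exact: (eos_drho he p0 r0)].
apply: derivableM; first exact: derivable_cst.
by apply: derivableV; [rewrite gt_eqF|exact: derivable_id].
Qed.

Lemma derivable_enth_p p rho : 0 < p -> 0 < rho -> derivable ((enth e)^~ rho) p 1.
Proof.
move=> p0 r0; apply: derivableD.
  by apply: derivableD; [exact: derivable_cst|exact: (eos_dp he p0 r0)].
by apply: derivableM; [exact: derivable_id|exact: derivable_cst].
Qed.

Lemma enth_nincr p rho1 rho2 : 0 < p -> 0 < rho1 -> rho1 <= rho2 ->
  enth e p rho2 <= enth e p rho1.
Proof.
move=> p0 r10 r12.
have pos x : x \in `[rho1, rho2] -> 0 < x.
  by rewrite in_itv/= => /andP[h _]; exact: lt_le_trans h.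
apply: (@ler0_derive1_nincr _ _ rho1 rho2) => //.
- by move=> x /subset_itv_oo_cc/pos; exact: derivable_enth_rho.
- move=> x /subset_itv_oo_cc/pos x0.
  by have /andP[_ /ltW] := eos_causal he p0 x0.
- by apply: derivable_within_continuous => x /pos; exact: derivable_enth_rho.
Qed.

(* Monotonicity in [rho] squeezes [enth e p (g p)] between two functions of [p]
   alone. *)
Lemma enth_continuous_along (g : R -> R) p : 0 < p -> 0 < g p ->
  {for p, continuous g} -> {for p, continuous (fun q => enth e q (g q))}.
Proof.
move=> p0 gp0 cg.
have crho rho : 0 < rho -> {for rho, continuous (enth e p)}.
  by move=> r0; apply/differentiable_continuous/derivable1_diffP/derivable_enth_rho.
have cp rho : 0 < rho -> {for p, continuous ((enth e)^~ rho)}.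
  by move=> r0; apply/differentiable_continuous/derivable1_diffP/derivable_enth_p.
apply/cvgrPdist_lt => eps eps0.
have eps20 : 0 < eps / 2 by rewrite divr_gt0.
have [d d0 dP] : exists2 d : R, 0 < d & forall r, `|g p - r| < d ->
    `|enth e p (g p) - enth e p r| < eps / 2.
  have /cvgrPdist_lt/(_ _ eps20)/nbhs_ballP[d /= d0 dP] := crho _ gp0.
  by exists d.
pose d' := Num.min d (g p) / 2.
have m1 : Num.min d (g p) <= d by rewrite ge_min lexx.
have m2 : Num.min d (g p) <= g p by rewrite ge_min lexx orbT.
have m0 : 0 < Num.min d (g p) by rewrite lt_min d0.
have d'0 : 0 < d' by rewrite divr_gt0.
have lo0 : 0 < g p - d' by rewrite /d'; lra.
have hi0 : 0 < g p + d' by lra.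
have lo := dP (g p - d'); have hi := dP (g p + d').
have /cvgrPdist_lt/(_ _ eps20) clo := cp _ lo0.
have /cvgrPdist_lt/(_ _ eps20) chi := cp _ hi0.
have /cvgrPdist_lt/(_ _ d'0) cgp := cg.
have pnear : \forall q \near p, 0 < q by exact: lt_nbhsr.
apply: filterS (filterI pnear (filterI cgp (filterI clo chi))) => q [q0 [gq [qlo qhi]]].
have {lo} lo : `|enth e p (g p) - enth e p (g p - d')| < eps / 2.
  by apply: lo; rewrite opprB subrKC gtr0_norm// /d'; lra.
have {hi} hi : `|enth e p (g p) - enth e p (g p + d')| < eps / 2.
  by apply: hi; rewrite opprD addNKr normrN gtr0_norm// /d'; lra.
move: gq; rewrite ltr_norml => /andP[gq1 gq2].
have h1 : enth e q (g q) <= enth e q (g p - d') by apply: enth_nincr => //; lra.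
have h2 : enth e q (g p + d') <= enth e q (g q) by apply: enth_nincr => //; lra.
move: lo hi qlo qhi; rewrite !ltr_norml => *; lra.
Qed.

(* [D] and [mu2] are the density and the square norm of the momentum. At the
   pressure [p] the velocity is [m / (E + p)] and [u] is the inverse Lorentz
   factor. *)
Lemma pressure_exists (D E mu2 : R) : 0 < D -> 0 <= mu2 -> Num.sqrt (D ^+ 2 + mu2) < E ->
  exists p, let u := Num.sqrt (1 - mu2 / (E + p) ^+ 2) in
    [/\ 0 < p, 0 < u & D * enth e p (D * u) = (E + p) * u].
Proof.
move=> D0 mu0 DE.
have E0 : 0 < E by apply: le_lt_trans DE; exact: sqrtr_ge0.
have E2 : D ^+ 2 + mu2 < E ^+ 2.
  by rewrite -(sqr_sqrtr (addr_ge0 (sqr_ge0 D) mu0)) ltr_pXn2r// nnegrE ?sqrtr_ge0// ltW.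
have D20 : 0 < D ^+ 2 by rewrite exprn_gt0.
pose u p := Num.sqrt (1 - mu2 / (E + p) ^+ 2).
have u_in p : 0 <= p -> mu2 / (E + p) ^+ 2 <= mu2 / E ^+ 2.
  move=> p0; rewrite ler_wpM2l// lef_pV2 ?posrE ?exprn_gt0//; last lra.
  by rewrite lerXn2r ?nnegrE//; lra.
have v0 : mu2 / E ^+ 2 < 1 by rewrite ltr_pdivrMr ?exprn_gt0//; lra.
have v_ge0 p : 0 <= p -> 0 <= mu2 / (E + p) ^+ 2.
  by move=> p0; rewrite divr_ge0// sqr_ge0.
have u_pos p : 0 <= p -> 0 < u p.
  by move=> p0; rewrite sqrtr_gt0; have := u_in _ p0; lra.
have u_le1 p : 0 <= p -> u p <= 1.
  by move=> p0; rewrite -sqrtr1 ler_wsqrtr//; have := v_ge0 _ p0; lra.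
have u_ge p : 0 <= p -> u 0 <= u p.
  by move=> p0; rewrite ler_wsqrtr// addr0; have := u_in _ p0; lra.
pose f p := D * enth e p (D * u p) - (E + p) * u p.
(* After squaring, this is [D^2 + mu2 < E^2]. *)
have Eu0 : D < E * u 0.
  rewrite -(ltr_pXn2r (n := 2))// ?nnegrE ?mulr_ge0 ?ltW ?u_pos//.
  rewrite exprMn sqr_sqrtr addr0; last by lra.
  by rewrite mulrBr mulr1 mulrCA divff ?gt_eqF ?exprn_gt0//; lra.
have rho0 : 0 < D * u 0 by rewrite mulr_gt0// u_pos.
(* [f p <= D * enth e p (D * u 0) - E * u 0], which tends to [D - E * u 0 < 0]. *)
have [p1 p10 fp1] : exists2 p, 0 < p & f p < 0.
  (* Solves [D * (1 + eps + eps) = E * u 0]; one [eps] bounds the internal energy, the other the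
     quotient of pressure and density. *)
  pose eps := (E * u 0 - D) / (2 * D).
  have eps0 : 0 < eps by rewrite divr_gt0//; lra.
  have /cvgrPdist_lt/(_ _ eps0) ce := eos_lim0 he rho0.
  have [p [p0 pe pr]] : exists p, [/\ 0 < p, `|0 - e p (D * u 0)| < eps & p < eps * (D * u 0)].
    have cr : \forall p \near 0^'+, p < eps * (D * u 0).
      by apply: nbhs_right_lt; rewrite mulr_gt0.
    have cp : \forall p \near (0 : R)^'+, 0 < p by exact: nbhs_right_gt.
    by have [p [a [b c]]] := filter_ex (filterI cp (filterI ce cr)); exists p.
  exists p => //; rewrite /f subr_lt0.
  have h1 : enth e p (D * u p) <= enth e p (D * u 0).
    by apply: enth_nincr => //; rewrite ler_pM2l// u_ge// ltW.
  have h2 : enth e p (D * u 0) < 1 + eps + eps.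
    rewrite /enth; have : p / (D * u 0) < eps by rewrite ltr_pdivrMr.
    by move: pe; rewrite sub0r normrN ltr_norml => /andP[_]; lra.
  have h3 : D * (1 + eps + eps) = E * u 0 by rewrite /eps; field; rewrite gt_eqF.
  have h4 : E * u 0 <= (E + p) * u p.
    by have := u_ge p (ltW p0); have := u_pos 0 (lexx 0); nra.
  by nra.
(* For large [p] the internal energy at density [D] exceeds [E / D], while [D * u p <= D] only
   increases the enthalpy. *)
have [p2 p12 fp2] : exists2 p, p1 < p & 0 < f p.
  have /cvgryPgt/(_ (E / D)) ce := eos_limy he D0.
  have [p [pp pe]] := filter_ex (filterI (nbhs_pinfty_gt (num_real p1)) ce).
  exists p => //; have p0 : 0 < p by exact: lt_trans pp.
  have up0 := u_pos _ (ltW p0).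
  have h1 : enth e p D <= enth e p (D * u p).
    by apply: enth_nincr => //; [rewrite mulr_gt0|rewrite ger_pMr// u_le1// ltW].
  have h2 : D * enth e p D = D * (1 + e p D) + p by rewrite /enth; field; rewrite gt_eqF.
  have h3 : E < D * e p D by rewrite mulrC -ltr_pdivrMr.
  have h4 : (E + p) * u p <= E + p by rewrite ger_pMr ?u_le1 ?ltW//; lra.
  by rewrite /f; nra.
have cu p : 0 < p -> {for p, continuous u}.
  move=> p0; apply: (cvg_comp _ Num.sqrt _ (@sqrt_continuous R _)).
  apply: cvgB; first exact: cvg_cst.
  apply: cvgM; first exact: cvg_cst.
  have Ep : E + p != 0 by rewrite gt_eqF//; lra.
  apply: cvgV; first by rewrite expf_neq0.
  rewrite expr2; under eq_fun do rewrite expr2.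
  by apply: cvgM; apply: cvgD; [exact: cvg_cst|exact: cvg_id|exact: cvg_cst|exact: cvg_id].
have cf : {within `[p1, p2], continuous f}.
  apply: continuous_in_subspaceT => p; rewrite inE/= in_itv/= => /andP[pp1 _].
  have p0 : 0 < p by exact: lt_le_trans pp1.
  apply: cvgB.
    apply: cvgM; first exact: cvg_cst.
    apply: (enth_continuous_along p0 (g := fun p => D * u p)).
      by rewrite mulr_gt0// u_pos// ltW.
    by apply: cvgM; [exact: cvg_cst|exact: cu].
  apply: cvgM; last exact: cu.
  by apply: cvgD; [exact: cvg_cst|exact: cvg_id].
have [|p] := @IVT _ f p1 p2 0 (ltW p12) cf.
  by rewrite ge_min le_max (ltW fp1) (ltW fp2) orbT.
rewrite in_itv/= => /andP[pp1 _] /eqP; rewrite subr_eq0 => /eqP fp.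
have p0 : 0 < p by exact: lt_le_trans pp1.
by exists p; split => //; exact: u_pos (ltW p0).
Qed.

End equation_of_state.

Section dot_product.
Context {R : realType}.
Implicit Types u v : 'rV[R]_3.

Lemma dotpC u v : dotp u v = dotp v u.
Proof. by rewrite !dotpE; ring. Qed.

Lemma dotp_ge0 u : 0 <= dotp u u.
Proof. by rewrite dotpE -!expr2 !addr_ge0 ?sqr_ge0. Qed.

Lemma dotp_eq0 u : dotp u u = 0 -> u = 0.
Proof.
rewrite /dotp mxE => /eqP; rewrite psumr_eq0 => [/allP h|j _]; last by rewrite mxE -expr2 sqr_ge0.
apply/rowP => j; rewrite mxE; have /implyP/(_ isT) := h j (mem_index_enum _).
by rewrite mxE -expr2 sqrf_eq0 => /eqP.
Qed.

Lemma dotp_cauchy_schwarz u v : dotp u v ^+ 2 <= dotp u u * dotp v v.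
Proof.
have E x y : dotp x y = \sum_(j < 3) x 0 j * y 0 j.
  by rewrite /dotp mxE; apply: eq_bigr => j _; rewrite mxE.
have E2 x : dotp x x = \sum_(j < 3) x 0 j ^+ 2.
  by rewrite E; apply: eq_bigr => j _; rewrite expr2.
by rewrite !E2 E; exact: cauchy_schwarz_sum.
Qed.

Lemma dotpZl (a : R) u v : dotp (a *: u) v = a * dotp u v.
Proof. by rewrite dotpC dotpZr dotpC. Qed.

End dot_product.

Section state_vectors.
Context {R : realType}.

Definition cons_vec (D : R) (m : 'cV[R]_3) (E : R) : 'cV[R]_5 :=
  (col_mx D%:M (col_mx m E%:M) : 'cV[R]_(1 + (3 + 1))).

Lemma stateE (D : R) m E : state D m E = cons_vec D m^T E.
Proof. by []. Qed.

Lemma cons_vec0 D m E : cons_vec D m E ord0 0 = D.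
Proof.
have := col_mxEu (D%:M : 'M[R]_1) (col_mx m (E%:M : 'M[R]_1)) 0 0.
rewrite [RHS]mxE eqxx mulr1n; apply: etrans.
by congr (fun_of_matrix _ _ _); exact: val_inj.
Qed.

Lemma cons_vec_mid D m E (i : 'I_5) (j : 'I_3) : i = j.+1 :> nat ->
  cons_vec D m E i 0 = m j 0.
Proof.
move=> ij; rewrite -[RHS](col_mxEu m (E%:M : 'M[R]_1)).
rewrite -[RHS](col_mxEd (D%:M : 'M[R]_1) (col_mx m (E%:M : 'M[R]_1))).
by congr (fun_of_matrix _ _ _); exact: val_inj.
Qed.

Lemma cons_vec4 D m E : cons_vec D m E ord_max 0 = E.
Proof.
have := col_mxEd m (E%:M : 'M[R]_1) 0 0.
rewrite [RHS]mxE eqxx mulr1n; apply: etrans.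
rewrite -[RHS](col_mxEd (D%:M : 'M[R]_1) (col_mx m (E%:M : 'M[R]_1))).
by congr (fun_of_matrix _ _ _); exact: val_inj.
Qed.

Lemma cons_vecD D m E D' m' E' :
  cons_vec D m E + cons_vec D' m' E' = cons_vec (D + D') (m + m') (E + E').
Proof. transitivity (col_mx (D%:M + D'%:M : 'M[R]_1)
    (col_mx m (E%:M : 'M[R]_1) + col_mx m' (E'%:M : 'M[R]_1))).
  exact: (@add_col_mx R 1 (3 + 1) 1).
by rewrite add_col_mx -!raddfD. Qed.

Lemma cons_vecZ (a : R) D m E : a *: cons_vec D m E = cons_vec (a * D) (a *: m) (a * E).
Proof. transitivity (col_mx (a *: D%:M : 'M[R]_1) (a *: col_mx m (E%:M : 'M[R]_1))).
  exact: (@scale_col_mx R 1 (3 + 1) 1).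
by rewrite scale_col_mx !scale_scalar_mx. Qed.

Lemma qfun_cons_vec D m E :
  qfun (cons_vec D m E) = E - Num.sqrt (D ^+ 2 + dotp m^T m^T).
Proof.
rewrite /qfun cons_vec4; congr (_ - Num.sqrt _).
rewrite big_mkcond big_ord_recl/= cons_vec0; congr (_ + _).
rewrite big_ord_recr/= addr0 /dotp mxE; apply: eq_bigr => j _ /=.
rewrite ifT; last by rewrite /bump /= add1n ltnS.
by rewrite (@cons_vec_mid _ _ _ _ j)// !mxE -expr2.
Qed.

Lemma cons_vec_surj (W : 'cV[R]_5) : exists D m E, W = cons_vec D m E.
Proof.
pose W' : 'cV[R]_(1 + (3 + 1)) := W.
exists (usubmx W' 0 0), (usubmx (dsubmx W')), (dsubmx (dsubmx W') 0 0).
transitivity (col_mx (usubmx W') (col_mx (usubmx (dsubmx W')) (dsubmx (dsubmx W')))).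
  by rewrite vsubmxK; exact: esym (vsubmxK W').
by rewrite /cons_vec -!mx11_scalar.
Qed.

End state_vectors.

Section spatial_metric.
Context {R : realType} (Om : set 'rV[R]_4) (M : adm R) (hM : is_spacetime Om M).
Variables (x : 'rV[R]_4) (hx : Om x).
Implicit Types u v : 'rV[R]_3.

(** Components in an orthonormal frame: as [R^T R = Ups], they turn the metric product into the
    Euclidean one. *)
Definition orth_frame u : 'rV[R]_3 := u *m (gam_root M x)^T.

Lemma gam_unit : gam M x \in unitmx.
Proof.
rewrite unitmxE unitfE; apply/negP => /eqP/eqP/det0P[v v0 vg].
by have := st_posdef hM hx v0; rewrite vg dotpE !mxE !mul0r !addr0 ltxx.
Qed.

(** The inverse of [\det (gam M x)] is the square of the determinant of [gam_root M x]. *)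
Lemma sqrtgam_gt0 : 0 < sqrtgam M x.
Proof.
rewrite sqrtr_gt0; have := congr1 determinant (st_root hM hx).
rewrite /Ups det_mulmx det_tr det_inv => d2.
rewrite -[ltRHS]invrK invr_gt0 -d2 -expr2 exprn_even_gt0//=.
apply: contraTneq gam_unit => d0; rewrite unitmxE -unitrV -d2 d0 mul0r.
by rewrite unitr0.
Qed.

Lemma gam_root_unit : gam_root M x \in unitmx.
Proof.
have : Ups M x \in unitmx by rewrite unitmx_inv gam_unit.
rewrite -(st_root hM hx) !unitmxE det_mulmx det_tr.
by rewrite unitrM => /andP[].
Qed.

Lemma dotp_Ups u v : dotp u (v *m Ups M x) = dotp (orth_frame u) (orth_frame v).
Proof.
rewrite /dotp /orth_frame -(st_root hM hx) !trmx_mul !trmxK; congr (_ 0 0).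
by rewrite !mulmxA.
Qed.

Lemma normsqE u : normsq M x u = dotp (orth_frame u) (orth_frame u).
Proof. by rewrite /normsq dotpC dotp_Ups. Qed.

Lemma orth_frame_inj : injective orth_frame.
Proof. by apply: can_inj (mulmxK _); rewrite unitmx_tr gam_root_unit. Qed.

Lemma orth_frameD u v : orth_frame (u + v) = orth_frame u + orth_frame v.
Proof. exact: mulmxDl. Qed.

Lemma orth_frameZ (a : R) u : orth_frame (a *: u) = a *: orth_frame u.
Proof. by rewrite /orth_frame scalemxAl. Qed.

Lemma Sigma_state D u E : Sigma M x *m state D u E = cons_vec D (orth_frame u)^T E.
Proof.
apply: etrans (@mul_block_col _ 1 (3 + 1) 1 (3 + 1) 1 _ _ _ _ _ _) _.
rewrite !mul0mx addr0 add0r mul1mx.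
by rewrite mul_block_col !mul0mx addr0 add0r mul1mx /cons_vec /orth_frame trmx_mul trmxK.
Qed.

Lemma normsq_ge0 u : 0 <= normsq M x u.
Proof. by rewrite normsqE dotp_ge0. Qed.

Lemma speed_sqr V : speed M x V ^+ 2 = dotp (orth_frame (vel V)) (orth_frame (vel V)).
Proof. by rewrite sqr_sqrtr ?normsq_ge0// normsqE. Qed.

Lemma speed_sqr_lt1 V : phys M x V -> speed M x V ^+ 2 < 1.
Proof. by case=> _ _ v1; rewrite expr_lt1 ?sqrtr_ge0. Qed.

Lemma lorentz_gt0 V : phys M x V -> 0 < lorentz M x V.
Proof. by move=> /speed_sqr_lt1 v1; rewrite invr_gt0 sqrtr_gt0 subr_gt0. Qed.

Lemma lorentz_sqr V : phys M x V -> lorentz M x V ^+ 2 * (1 - speed M x V ^+ 2) = 1.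
Proof.
move=> /speed_sqr_lt1 v1; rewrite exprVn sqr_sqrtr ?subr_ge0 1?ltW//.
by rewrite mulVf// subr_eq0 gt_eqF.
Qed.

(** After removal of the factor [sqrtgam] and of the frame, [pressure_exists] gives [p], and then
    density [D * u] and velocity [m / (E + p)]. *)
Lemma primW_correct e (W : 'cV[R]_5) : is_eos e -> Gstar W ->
  phys M x (primW e M x W) /\ Wof e M x (primW e M x W) = W.
Proof.
move=> he; have [D' [m' [E' ->]]] := cons_vec_surj W; rewrite /Gstar/= cons_vec0 qfun_cons_vec.
move=> [D'0 /[!subr_gt0] DE'].
suff h : exists V : R * R * 'rV[R]_3, phys M x V /\ Wof e M x V = cons_vec D' m' E'.
  exact: (xgetPex (0, 0, 0) h).
have g0 := sqrtgam_gt0; set g := sqrtgam M x in g0 *.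
pose D := g^-1 * D'; pose E := g^-1 * E'; pose n := g^-1 *: m'^T.
have gV0 : 0 < g^-1 by rewrite invr_gt0.
have [m mE] : exists m, orth_frame m = n.
  exists (n *m invmx (gam_root M x)^T); rewrite /orth_frame mulmxKV//.
  by rewrite unitmx_tr gam_root_unit.
have D0 : 0 < D by rewrite mulr_gt0.
have DE : Num.sqrt (D ^+ 2 + dotp n n) < E.
  rewrite /n dotpZl dotpZr mulrA -expr2 exprMn -mulrDr sqrtrM ?sqr_ge0//.
  by rewrite sqrtr_sqr gtr0_norm// ltr_pM2l.
have [p [p0 u0 heq]] := pressure_exists he D0 (dotp_ge0 n) DE.
set u := Num.sqrt _ in u0 heq.
have E0 : 0 < E by apply: le_lt_trans DE; exact: sqrtr_ge0.
have s0 : 0 < E + p by rewrite addr_gt0.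
pose V : R * R * 'rV[R]_3 := (D * u, p, (E + p)^-1 *: m).
have v2 : speed M x V ^+ 2 = dotp n n / (E + p) ^+ 2.
  rewrite speed_sqr /V/= orth_frameZ mE dotpZl dotpZr mulrA -expr2 exprVn mulrC.
  by [].
have wE : lorentz M x V = u^-1 by rewrite /lorentz v2.
have u2 : u ^+ 2 = 1 - dotp n n / (E + p) ^+ 2.
  by rewrite sqr_sqrtr//; move: u0; rewrite sqrtr_gt0 => /ltW.
exists V; split.
  split => //; first by rewrite mulr_gt0.
  rewrite -(ltr_pXn2r (n := 2))// ?nnegrE ?sqrtr_ge0// expr1n v2.
  by move: u0; rewrite sqrtr_gt0 subr_gt0.
(* The equation for [p] says exactly that [rho h w^2 = E + p]. *)
have rhw : dens V * enthV e V * lorentz M x V ^+ 2 = E + p.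
  rewrite wE /enthV /dens /pres /=.
  have -> : D * u * enth e p (D * u) * u^-1 ^+ 2 = D * enth e p (D * u) * u^-1.
    by field; rewrite gt_eqF.
  by rewrite heq mulfK// gt_eqF.
rewrite /Wof Sigma_state /consD /consm /consE rhw wE/= -/g.
rewrite cons_vecZ; congr cons_vec.
- by rewrite mulfK ?gt_eqF// mulrA divff ?gt_eqF// mul1r.
- rewrite scalerA divff ?gt_eqF// scale1r mE /n linearZ/= trmxK scalerA.
  by rewrite divff ?gt_eqF// scale1r.
- by rewrite addrK mulrA divff ?gt_eqF// mul1r.
Qed.

End spatial_metric.

(** * The speed bounds *)

Section flux_cone.
Context {R : realType}.
Implicit Types v xi : 'rV[R]_3.

(* With [H = rho h], [b] the speed relative to the moving frame and
   [A = H^2 - 2 H p - rho^2], the vector below satisfies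
   [E^2 - D^2 - |m|^2 = w^2 (b - v.xi)^2 A + p^2 (b^2 - |xi|^2)].
   This gives the sign of [E] as well: [E] increases with [b], and were it
   negative at [b], it would vanish at a larger speed, where
   [E^2 - D^2 - |m|^2 >= 0] fails. *)
Lemma qfun_flux_ge0 (rho p H w b : R) v xi :
  0 < rho -> 0 < p -> p < H -> 0 < w -> w ^+ 2 * (1 - dotp v v) = 1 ->
  (forall b', b <= b' -> dotp xi v < b' /\
    0 <= w ^+ 2 * (b' - dotp xi v) ^+ 2 * (H ^+ 2 - 2 * H * p - rho ^+ 2)
         + p ^+ 2 * (b' ^+ 2 - dotp xi xi)) ->
  let c := b - dotp xi v in
  0 <= qfun (cons_vec (rho * w * c) (c *: ((H * w ^+ 2) *: v) - p *: xi)^T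
               ((H * w ^+ 2 - p) * c - p * dotp xi v)).
Proof.
move=> r0 p0 pH w0 wv hb /=.
set s := dotp xi v in hb *.
pose En (b' : R) := (H * w ^+ 2 - p) * (b' - s) - p * s.
have key b' : En b' ^+ 2 - ((rho * w * (b' - s)) ^+ 2 +
    dotp ((b' - s) *: ((H * w ^+ 2) *: v) - p *: xi)
         ((b' - s) *: ((H * w ^+ 2) *: v) - p *: xi)) =
    w ^+ 2 * (b' - s) ^+ 2 * (H ^+ 2 - 2 * H * p - rho ^+ 2)
         + p ^+ 2 * (b' ^+ 2 - dotp xi xi).
  have -> : dotp ((b' - s) *: ((H * w ^+ 2) *: v) - p *: xi)
                 ((b' - s) *: ((H * w ^+ 2) *: v) - p *: xi) =
      (b' - s) ^+ 2 * H ^+ 2 * w ^+ 4 * dotp v v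
      - 2 * (b' - s) * H * w ^+ 2 * p * s + p ^+ 2 * dotp xi xi.
    by rewrite /s !dotpE !mxE; ring.
  transitivity (w ^+ 2 * (b' - s) ^+ 2 * (H ^+ 2 - 2 * H * p - rho ^+ 2)
      + p ^+ 2 * (b' ^+ 2 - dotp xi xi)
      + (b' - s) ^+ 2 * H ^+ 2 * w ^+ 2 * (w ^+ 2 * (1 - dotp v v) - 1)).
    by rewrite /En; ring.
  by rewrite wv subrr mulr0 addr0.
have w1 : 1 <= w ^+ 2.
  by rewrite -[leLHS]wv ger_pMr ?exprn_gt0// lerBlDr lerDl dotp_ge0.
have Hw : 0 < H * w ^+ 2 - p by rewrite subr_gt0; nra.
have E0 : 0 <= En b.
  rewrite leNgt; apply/negP => Eb.
  pose b' := s + p * s / (H * w ^+ 2 - p).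
  have Eb' : En b' = 0 by rewrite /En /b'; field; rewrite gt_eqF.
  have bb' : b <= b'.
    rewrite -subr_ge0 -(pmulr_rge0 _ Hw).
    have -> : (H * w ^+ 2 - p) * (b' - b) = - En b.
      by rewrite -[RHS]addr0 -Eb' /En; ring.
    by rewrite oppr_ge0 ltW.
  have [sb' q] := hb _ bb'; move: q; rewrite -key Eb' expr0n/= sub0r oppr_ge0.
  apply/negP; rewrite -ltNge ltr_pwDl// ?dotp_ge0//.
  by rewrite exprn_gt0// !mulr_gt0// subr_gt0.
have [_] := hb b (lexx b); rewrite -key subr_ge0 => h.
rewrite qfun_cons_vec trmxK subr_ge0 -/(En b).
by rewrite -(ger0_norm E0) -sqrtr_sqr ler_wsqrtr.
Qed.

Lemma dotp_lt_norm v xi : dotp v v < 1 -> 0 < dotp xi xi -> dotp xi v ^+ 2 < dotp xi xi.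
Proof.
move=> v1 x0; apply: le_lt_trans (dotp_cauchy_schwarz _ _) _.
by rewrite gtr_pMr.
Qed.

(** Both terms are nonnegative, since [H^2 - 2 H p - rho^2 = (H - p)^2 - p^2 - rho^2]. *)
Lemma general_speed_ok (rho p H w b : R) v xi : 0 < p -> 0 < rho ->
  rho ^+ 2 + p ^+ 2 <= (H - p) ^+ 2 -> dotp v v < 1 -> 0 < dotp xi xi ->
  Num.sqrt (dotp xi xi) <= b ->
  dotp xi v < b /\
    0 <= w ^+ 2 * (b - dotp xi v) ^+ 2 * (H ^+ 2 - 2 * H * p - rho ^+ 2)
         + p ^+ 2 * (b ^+ 2 - dotp xi xi).
Proof.
move=> p0 r0 hH v1 x0 xb; have b0 : 0 <= b by apply: le_trans xb; exact: sqrtr_ge0.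
have xb2 : dotp xi xi <= b ^+ 2.
  by rewrite -(sqr_sqrtr (ltW x0)) ler_pXn2r// nnegrE sqrtr_ge0.
have s2 := dotp_lt_norm v1 x0; split; first by nra.
apply: addr_ge0; apply: mulr_ge0; rewrite ?sqr_ge0 ?subr_ge0//.
  by rewrite mulr_ge0 ?sqr_ge0.
by lra.
Qed.

(** With [A = H^2 - 2 H p - rho^2] one has [p^2 (1 - c2) <= c2 A], so it suffices that [w^2 (b -
    s)^2 (1 - c2) + c2 (b^2 - |xi|^2) >= 0] with [s = xi.v]. For [|s|] in place of [s], the speed
    bound is the larger root of this quadratic in [b]. *)
Lemma ideal_speed_ok (Gam rho p w b : R) v xi :
  let H := rho + Gam * p / (Gam - 1) in let c2 := Gam * p / H in
  0 < p -> 0 < rho -> 1 < Gam <= 2 -> 0 < w -> w ^+ 2 * (1 - dotp v v) = 1 ->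
  0 < dotp xi xi ->
  (1 - dotp v v * c2)^-1 * (`|dotp xi v| * (1 - c2) + Num.sqrt c2 * w^-1 *
    Num.sqrt ((1 - dotp v v * c2) * dotp xi xi - (1 - c2) * dotp xi v ^+ 2)) <= b ->
  dotp xi v < b /\
    0 <= w ^+ 2 * (b - dotp xi v) ^+ 2 * (H ^+ 2 - 2 * H * p - rho ^+ 2)
         + p ^+ 2 * (b ^+ 2 - dotp xi xi).
Proof.
move=> H c2 p0 r0 /andP[G1 G2] w0 wv x0.
have w20 : 0 < w ^+ 2 by rewrite exprn_gt0.
have v_ge0 := dotp_ge0 v.
have v1 : dotp v v < 1 by rewrite -subr_gt0 -(pmulr_rgt0 _ w20) wv.
have s_lt := dotp_lt_norm v1 x0; have s_cs := dotp_cauchy_schwarz xi v.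
set V2 := dotp v v in wv v1 v_ge0 s_cs *; set X2 := dotp xi xi in x0 s_lt s_cs *.
set s := dotp xi v in s_lt s_cs *.
have G0 : 0 < Gam - 1 by rewrite subr_gt0.
have Gp : 0 < Gam * p by rewrite mulr_gt0// (lt_trans _ G1).
have GpH : Gam * p < H.
  rewrite /H (@le_lt_trans _ _ (Gam * p / (Gam - 1)))// ?ltrDr//.
  by rewrite ler_pdivlMr// ger_pMr//; lra.
have H0 : 0 < H by exact: lt_trans GpH.
have c0 : 0 < c2 by rewrite divr_gt0.
have c1 : c2 < 1 by rewrite ltr_pdivrMr// mul1r.
set A := H ^+ 2 - 2 * H * p - rho ^+ 2.
(* Times [H], the difference is a positive factor times a sum of two terms, the second nonnegative
   because [Gam <= 2]. *)
have cA : p ^+ 2 * (1 - c2) <= c2 * A.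
  rewrite -(ler_pM2r H0) -subr_ge0.
  have -> : c2 * A * H - p ^+ 2 * (1 - c2) * H = p / (Gam - 1) ^+ 2 *
      (p * rho * (Gam - 1) * (Gam + 1) + Gam * p ^+ 2 * (2 - Gam)).
    rewrite /A /c2 /H; field; rewrite gt_eqF//=.
    have -> : rho * (Gam - 1) + Gam * p = H * (Gam - 1) by rewrite /H; field; rewrite gt_eqF.
    by rewrite mulf_neq0 ?gt_eqF.
  apply: mulr_ge0; first by rewrite divr_ge0 ?sqr_ge0// ltW.
  have pr0 : 0 <= p * rho by rewrite mulr_ge0 ?ltW.
  apply: addr_ge0; first by rewrite !(mulr_ge0 pr0, mulr_ge0)//; lra.
  by apply: mulr_ge0; [rewrite mulr_ge0 ?sqr_ge0//|]; lra.
pose k := 1 - V2 * c2; pose y := `|s|.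
have y0 : 0 <= y by exact: normr_ge0.
have y2 : y ^+ 2 = s ^+ 2 by exact: real_normK (num_real _).
have sy : s <= y by exact: ler_norm.
have k0 : 0 < k by rewrite /k subr_gt0; nra.
pose Del := k * X2 - (1 - c2) * y ^+ 2.
have Del1 : y ^+ 2 * (c2 * (1 - V2)) < Del.
  rewrite -subr_gt0; have -> : Del - y ^+ 2 * (c2 * (1 - V2)) = k * (X2 - y ^+ 2).
    by rewrite /Del /k; ring.
  by rewrite mulr_gt0// subr_gt0 y2.
have cv0 : 0 < c2 * (1 - V2) by rewrite mulr_gt0// subr_gt0.
have Del0 : 0 < Del by apply: le_lt_trans Del1; rewrite mulr_ge0 ?sqr_ge0// ltW.
(* The radicals merge because [w^-1] is the square root of [1 - V2]. *)
have -> : Num.sqrt c2 * w^-1 * Num.sqrt ((1 - V2 * c2) * X2 - (1 - c2) * s ^+ 2) =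
    Num.sqrt (c2 * (1 - V2) * Del).
  have wV : w^-1 = Num.sqrt (1 - V2).
    rewrite -[LHS]gtr0_norm ?invr_gt0// -sqrtr_sqr; congr Num.sqrt.
    by rewrite exprVn -[RHS](mulKf (lt0r_neq0 w20)) wv mulr1.
  rewrite wV -sqrtrM ?ltW// -sqrtrM ?ltW//; congr Num.sqrt.
  by rewrite /Del y2.
rewrite -/k -/y mulrC ler_pdivrMr// [b * k]mulrC.
set Q := Num.sqrt _; have Q2 : Q ^+ 2 = c2 * (1 - V2) * Del.
  by rewrite sqr_sqrtr// mulr_ge0 ?ltW.
have Q0 : 0 <= Q by exact: sqrtr_ge0.
move=> kb; have yb : y < b.
  have Qy : y * (c2 * (1 - V2)) < Q.
    have yc0 : 0 <= y * (c2 * (1 - V2)) by rewrite mulr_ge0// ltW.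
    rewrite -(ltr_pXn2r (n := 2))// ?nnegrE// Q2.
    rewrite -subr_gt0; have -> : c2 * (1 - V2) * Del - (y * (c2 * (1 - V2))) ^+ 2 =
      c2 * (1 - V2) * (Del - y ^+ 2 * (c2 * (1 - V2))) by ring.
    by rewrite mulr_gt0// subr_gt0.
  rewrite -(ltr_pM2l k0) (lt_le_trans _ kb)//.
  by move: Qy; rewrite /k; lra.
have sb : s < b by exact: le_lt_trans yb.
split => //.
(* Times [k], this is the completed square [(k b - y (1 - c2))^2 >= Q^2]. *)
have G : c2 * (1 - V2) * (X2 - b ^+ 2) <= (b - y) ^+ 2 * (1 - c2).
  rewrite -(ler_pM2l k0) -subr_ge0.
  have -> : k * ((b - y) ^+ 2 * (1 - c2)) - k * (c2 * (1 - V2) * (X2 - b ^+ 2)) =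
      (k * b - y * (1 - c2)) ^+ 2 - Q ^+ 2.
    by rewrite Q2 /Del /k; ring.
  rewrite subr_ge0 lerXn2r ?nnegrE//; lra.
have bys : (b - y) ^+ 2 <= (b - s) ^+ 2 by rewrite lerXn2r ?nnegrE; lra.
have A0 : 0 <= A.
  by rewrite -(pmulr_rge0 _ c0); apply: le_trans cA; rewrite mulr_ge0 ?sqr_ge0//; lra.
rewrite -(pmulr_rge0 _ c0).
have h1 : w ^+ 2 * (b - y) ^+ 2 * (c2 * A) <= w ^+ 2 * (b - s) ^+ 2 * (c2 * A).
  apply: ler_wpM2r; first by rewrite mulr_ge0// ltW.
  by rewrite ler_wpM2l// ltW.
have h2 : w ^+ 2 * (b - y) ^+ 2 * (p ^+ 2 * (1 - c2)) <= w ^+ 2 * (b - y) ^+ 2 * (c2 * A).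
  by rewrite ler_wpM2l// mulr_ge0 ?sqr_ge0.
have h3 : w ^+ 2 * p ^+ 2 * (c2 * (1 - V2) * (X2 - b ^+ 2)) <=
    w ^+ 2 * p ^+ 2 * ((b - y) ^+ 2 * (1 - c2)).
  by rewrite ler_wpM2l// mulr_ge0 ?sqr_ge0.
have h4 : w ^+ 2 * p ^+ 2 * (c2 * (1 - V2) * (X2 - b ^+ 2)) = c2 * p ^+ 2 * (X2 - b ^+ 2).
  transitivity (w ^+ 2 * (1 - V2) * (c2 * p ^+ 2 * (X2 - b ^+ 2))); first by ring.
  by rewrite wv mul1r.
by lra.
Qed.

End flux_cone.

(** The closed formula for the enthalpy holds only at positive arguments, so it is differentiated
    through equality near the point. *)
Lemma soundsq_ideal (R : realType) (e : R -> R -> R) (Gam p rho : R) :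
  is_ideal Gam e -> 0 < p -> 0 < rho ->
  soundsq e p rho = Gam * p / (rho * enth e p rho).
Proof.
case=> /andP[G1 _] hid p0 r0.
have G0 : Gam - 1 != 0 by rewrite gt_eqF// subr_gt0.
have dpE : dp (enth e) p rho = Gam / ((Gam - 1) * rho).
  have D : is_derive p 1 (cst 1 + (Gam / ((Gam - 1) * rho)) \*: (id : R -> R)) _ :=
    is_deriveD (is_derive_cst _ _ _) (is_deriveZ _ (is_derive_id _ _)).
  rewrite /dp derive1E (@derive_val _ _ _ _ _ _ _ (near_eq_is_derive _ D)).
    by rewrite add0r /GRing.scale/= mulr1.
  have : \forall q \near p, 0 < q by exact: lt_nbhsr.
  by apply: filterS => q q0; rewrite hid// mulrAC.
have drE : drho (enth e) p rho = - (Gam * p / ((Gam - 1) * rho ^+ 2)).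
  have r_neq0 : (id rho : R) != 0 by rewrite gt_eqF.
  have D : is_derive rho 1 (cst 1 + (Gam * p / (Gam - 1)) \*: (fun q : R => q^-1)) _ :=
    is_deriveD (is_derive_cst _ _ _) (is_deriveZ _ (is_deriveV r_neq0 (is_derive_id _ _))).
  rewrite /drho derive1E (@derive_val _ _ _ _ _ _ _ (near_eq_is_derive _ D)).
    by rewrite add0r /GRing.scale/= mulr1; field; rewrite G0 gt_eqF.
  have : \forall q \near rho, 0 < q by exact: lt_nbhsr.
  by apply: filterS => q q0; rewrite hid// invfM mulrA.
have e0 : enth e p rho != 0.
  rewrite hid// gt_eqF// addr_gt0// divr_gt0 ?mulr_gt0 ?subr_gt0//.
  exact: lt_trans G1.
rewrite /soundsq; have -> : rho^-1 - dp (enth e) p rho = - ((Gam - 1) * rho)^-1.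
  by rewrite dpE; field; rewrite G0 gt_eqF.
by rewrite drE; field; rewrite e0 G0 gt_eqF.
Qed.

Section flux_in_cone.
Context {R : realType} (e : R -> R -> R) (he : is_eos e).
Context (Om : set 'rV[R]_4) (M : adm R) (hM : is_spacetime Om M).
Variables (x : 'rV[R]_4) (hx : Om x).

Lemma sum_cons_vec (n : nat) (c D E : 'I_n -> R) (m : 'I_n -> 'cV[R]_3) :
  \sum_(l < n) c l *: cons_vec (D l) (m l) (E l) =
  cons_vec (\sum_(l < n) c l * D l) (\sum_(l < n) c l *: m l) (\sum_(l < n) c l * E l).
Proof.
elim: n c D E m => [|n IH] c D E m.
  rewrite !big_ord0; have := cons_vecZ 0 0 (0 : 'cV[R]_3) 0.
  by rewrite !scaler0 !mulr0 => <-; rewrite scale0r.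
by rewrite !big_ord_recr/= IH cons_vecZ cons_vecD.
Qed.

Lemma dotp_sum (u v : 'rV[R]_3) : dotp u v = \sum_(l < 3) u 0 l * v 0 l.
Proof. by rewrite /dotp mxE; apply: eq_bigr => l _; rewrite mxE. Qed.

Lemma normal_flux (xi : 'rV[R]_3) (W : 'cV[R]_5) : let V := primW e M x W in
  \sum_(l < 3) xi 0 l *: fluxH e M x W l =
  sqrtmg M x *: cons_vec (consD M x V * dotp xi (velt M x V))
    (orth_frame M x (dotp xi (velt M x V) *: consm e M x V + pres V *: xi))^T
    (consE e M x V * dotp xi (velt M x V) + pres V * dotp xi (velup M x V)).
Proof.
move=> V; under eq_bigr => l _.
  rewrite /fluxH Sigma_state scalerA mulrC -scalerA.
  over.
rewrite -scaler_sumr sum_cons_vec -/V; congr (_ *: cons_vec _ _ _).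
- by rewrite dotp_sum mulr_sumr; apply: eq_bigr => l _; ring.
- under eq_bigr do rewrite -linearZ/= -orth_frameZ.
  rewrite -linear_sum/= -mulmx_suml; congr (_ *m _)^T.
  under eq_bigr do rewrite scalerDr scalerA.
  rewrite big_split/= -scaler_suml -dotp_sum; congr (_ + _).
  under eq_bigr do rewrite scalerA mulrC -scalerA.
  by rewrite -scaler_sumr -row_sum_delta.
- rewrite !dotp_sum !mulr_sumr -big_split/=.
  by apply: eq_bigr => l _; ring.
Qed.

(** In the orthonormal frame, [Z] is a positive multiple of the vector of [qfun_flux_ge0]. *)
Lemma flux_in_cone eta (heta : is_speed_bound e M eta) (xi : 'rV[R]_3) (W : 'cV[R]_5) (a : R) :
  xi != 0 -> Gstar W -> eta xi x W <= a ->
  let Z := a *: W - \sum_(l < 3) xi 0 l *: fluxH e M x W l in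
  0 <= Z ord0 0 /\ 0 <= qfun Z.
Proof.
move=> xi0 WG etaa; rewrite normal_flux.
have [Vph VW] := primW_correct hM hx he WG.
set V := primW e M x W in Vph VW etaa *.
have [r0 p0 _] := Vph.
have w0 := lorentz_gt0 Vph; have w1 := lorentz_sqr Vph.
have g0 := sqrtgam_gt0 hM hx; have al0 := st_lapse hM hx.
pose v := orth_frame M x (vel V); pose xi' := orth_frame M x xi.
rewrite (speed_sqr hM hx) -/v in w1.
have xi'0 : 0 < dotp xi' xi'.
  rewrite lt_neqAle dotp_ge0 andbT eq_sym; apply: contra xi0 => /eqP/dotp_eq0 E.
  apply/eqP/(orth_frame_inj hM hx); rewrite -/xi' E.
  by rewrite /orth_frame mul0mx.
pose H := dens V * enthV e V.
(* The transport velocity [v - beta / alpha] in the flux adds [xi.beta / alpha] to the speed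
   [a / alpha]. *)
pose b := a / lapse M x + dotp xi (shift_up M x) / lapse M x.
have sE : dotp xi (velup M x V) = dotp xi' v by rewrite (dotp_Ups hM hx).
have stE : dotp xi (velt M x V) = dotp xi' v - dotp xi (shift_up M x) / lapse M x.
  by rewrite /velt dotpDr dotpNr dotpZr sE [_^-1 * _]mulrC.
have comb (y z : 'rV[R]_3) (a1 s1 t1 B q : R) :
    a1 *: (B *: y)^T + -1 *: ((s1 - t1) *: (B *: y) + q *: z)^T =
    ((a1 + t1 - s1) *: (B *: y) - q *: z)^T.
  by apply/colP => j; rewrite !mxE; ring.
set w := lorentz M x V in w0 w1.
have mE : orth_frame M x (consm e M x V) = (H * w ^+ 2) *: v.
  by rewrite /consm orth_frameZ.
have -> : a *: W - sqrtmg M x *: cons_vec (consD M x V * dotp xi (velt M x V))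
    (orth_frame M x (dotp xi (velt M x V) *: consm e M x V + pres V *: xi))^T
    (consE e M x V * dotp xi (velt M x V) + pres V * dotp xi (velup M x V)) =
  sqrtmg M x *: cons_vec (dens V * w * (b - dotp xi' v))
     ((b - dotp xi' v) *: ((H * w ^+ 2) *: v) - pres V *: xi')^T
     ((H * w ^+ 2 - pres V) * (b - dotp xi' v) - pres V * dotp xi' v).
  rewrite -{1}VW /Wof Sigma_state scalerA.
  have -> : a * sqrtgam M x = sqrtmg M x * (a / lapse M x).
    by rewrite /sqrtmg; field; rewrite gt_eqF.
  rewrite -scalerA -scalerBr; congr (_ *: _).
  rewrite -scaleN1r !cons_vecZ cons_vecD; congr cons_vec.
  - by rewrite /consD -/w stE /b; ring.
  - rewrite orth_frameD !orth_frameZ -/xi' stE /b.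
    exact: comb.
  - by rewrite sE stE /consE /b /H -/w; ring.
have gm0 : 0 < sqrtmg M x by rewrite mulr_gt0.
(* Times [rho], the bound [eos_rel] reads [sqrt (rho^2 + p^2) <= H - p]. *)
have rel : dens V ^+ 2 + pres V ^+ 2 <= (H - pres V) ^+ 2 /\ pres V < H.
  have := eos_rel he p0 r0; rewrite -/(enthV e V) => hrel.
  have sq0 := sqrtr_ge0 (1 + pres V ^+ 2 / dens V ^+ 2).
  have pos : 0 <= 1 + pres V ^+ 2 / dens V ^+ 2.
    by rewrite addr_ge0// divr_ge0 ?sqr_ge0.
  set q := Num.sqrt _ in hrel sq0.
  have q2 : dens V ^+ 2 * q ^+ 2 = dens V ^+ 2 + pres V ^+ 2.
    by rewrite sqr_sqrtr//; field; rewrite gt_eqF.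
  have h1 : dens V * q <= H - pres V.
    have -> : H - pres V = dens V * (enthV e V - pres V / dens V).
      by rewrite /H; field; rewrite gt_eqF.
    by rewrite ler_pM2l//; lra.
  have h2 : 0 < q.
    by rewrite sqrtr_gt0 ltr_pwDl// divr_ge0 ?sqr_ge0.
  have h3 : 0 < dens V * q by rewrite mulr_gt0.
  split; last by lra.
  have h4 : 0 < H - pres V by exact: lt_le_trans h1.
  by rewrite -q2 -exprMn lerXn2r// nnegrE ltW.
have v1 : dotp v v < 1.
  by rewrite -subr_gt0 -(pmulr_rgt0 _ (exprn_gt0 2 w0)) w1.
have shift_b c : lapse M x * (c + shiftspeed M x xi) <= a -> c <= b.
  rewrite mulrC -ler_pdivlMr// /b /shiftspeed => h.
  have : - (dotp xi (shift_up M x) / lapse M x) <= `|dotp xi (shift_up M x)| / lapse M x.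
    by rewrite -mulNr ler_pM2r ?invr_gt0// -normrN ler_norm.
  by lra.
have ok b' : b <= b' -> dotp xi' v < b' /\
    0 <= w ^+ 2 * (b' - dotp xi' v) ^+ 2 * (H ^+ 2 - 2 * H * pres V - dens V ^+ 2)
         + pres V ^+ 2 * (b' ^+ 2 - dotp xi' xi').
  move=> bb'; case: heta => [eE|[[Gam hid] eE]]; rewrite eE in etaa.
    apply: general_speed_ok => //; first by case: rel.
    apply: le_trans bb'; apply: shift_b.
    by move: etaa; rewrite /eta_general (normsqE hM hx).
  have [G12 hidE] := hid.
  have HE : H = dens V + Gam * pres V / (Gam - 1).
    rewrite /H /enthV hidE//; field.
    by rewrite !gt_eqF// subr_gt0; case/andP: G12.
  rewrite HE; apply: ideal_speed_ok => //.
  rewrite -HE; apply: le_trans bb'; apply: shift_b.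
  move: etaa; rewrite /eta_ideal (normsqE hM hx) -/V (speed_sqr hM hx) -/v -/xi' sE.
  by rewrite (soundsq_ideal hid)// -/(enthV e V) -/H -/w.
have [_ pH] := rel.
have q0 := qfun_flux_ge0 r0 p0 pH w0 w1 ok.
lazy zeta; rewrite qfunZ ?(ltW gm0)// mxE cons_vec0; split; last by rewrite mulr_ge0// ltW.
rewrite mulr_ge0 ?(ltW gm0)// mulr_ge0 ?mulr_ge0 ?(ltW r0) ?(ltW w0)//.
by have [+ _] := ok b (lexx b); rewrite subr_ge0 => /ltW.
Qed.

Lemma Sigma_row0 (y : 'rV[R]_4) (j : 'I_5) : Sigma M y ord0 j = (j == ord0)%:R.
Proof.
have [j0|j0] := eqVneq j ord0.
  rewrite j0; have := block_mxEul (1%:M : 'M[R]_1) 0 0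
    (block_mx (gam_root M y) 0 0 1%:M : 'M[R]_(3 + 1)) 0 0.
  rewrite [RHS]mxE eqxx; apply: etrans.
  by congr (fun_of_matrix _ _ _); exact: val_inj.
have hj : (j.-1 < 3 + 1)%N by case: j j0 => [[|m] h] //=.
have := block_mxEur (1%:M : 'M[R]_1) 0 0
    (block_mx (gam_root M y) 0 0 1%:M : 'M[R]_(3 + 1)) 0 (Ordinal hj).
rewrite [RHS]mxE; apply: etrans.
congr (fun_of_matrix _ _ _); apply: val_inj => //=.
by case: j j0 {hj} => [[|m] h].
Qed.

(** The first row of [Sigma] is constant, so its derivatives vanish, and [sourceQ] has first
    component 0. *)
Lemma sourceS_row0 (W : 'cV[R]_5) : sourceS e M x W ord0 0 = 0.
Proof.
have D0 mu (U : 'cV[R]_5) : (mxpder mu (Sigma M) x *m U) ord0 0 = 0.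
  rewrite mxE big1// => j _; rewrite mxE /pder.
  under eq_fun do rewrite Sigma_row0.
  by rewrite derive_cst mul0r.
have addE (A B : 'cV[R]_5) : (A + B) ord0 0 = A ord0 0 + B ord0 0 by rewrite mxE.
have scaleE c (A : 'cV[R]_5) : (c *: A) ord0 0 = c * A ord0 0 by rewrite mxE.
rewrite /sourceS addE !scaleE addE D0 summxE big1 => [|j _]; last exact: D0.
by rewrite /sourceQ stateE cons_vec0 addr0 !mulr0 addr0.
Qed.

End flux_in_cone.

(** * The scheme *)

(** The two weak inequalities define a convex cone that contains 0, so the empty sum is covered. *)
Lemma cone_sum (R : realType) (J : eqType) (s : seq J) (c : J -> R) (Z : J -> 'cV[R]_5) :
  (forall j, j \in s -> 0 <= c j) ->
  (forall j, j \in s -> 0 <= Z j ord0 0 /\ 0 <= qfun (Z j)) ->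
  0 <= (\sum_(j <- s) c j *: Z j) ord0 0 /\ 0 <= qfun (\sum_(j <- s) c j *: Z j).
Proof.
elim: s => [|j s IH] c0 Zc.
  by rewrite big_nil mxE -[X in qfun X](scale0r 0) qfunZ// mul0r.
have [|i is_|S0 qS] := IH.
- by move=> i is_; apply: c0; rewrite in_cons is_ orbT.
- by apply: Zc; rewrite in_cons is_ orbT.
have [Z0 qZ] := Zc j (mem_head _ _); have cj := c0 j (mem_head _ _).
rewrite big_cons mxE [X in X + _]mxE addr_ge0 ?mulr_ge0//; split => //.
by apply: le_trans (qfunD _ _); rewrite qfunZ// addr_ge0 ?mulr_ge0.
Qed.

(* The flux of the cell itself drops out because its outer normals, weighted by
   the areas of the faces, add up to zero. *)
Lemma LxF_update_split (R : realType) (e : R -> R -> R) (M : adm R)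
    (X : set 'rV[R]_3) (K : eqType) (T : mesh X K) (t dt : R)
    (a : K -> K -> R) (W : K -> 'cV[R]_5) (k : K) :
  let S := sourceS e M (event t (cell_center T k)) (W k) in
  let sumA := \sum_(j <- nbr T k) a k j * areaE T k j in
  LxF_update e M T t dt a W k =
  ((1 - dt * ((2 * volI T k)^-1 * sumA)) *: W k + dt *: S) +
  (dt / volI T k / 2) *: \sum_(j <- nbr T k) areaE T k j *:
    (a k j *: W j - \sum_(l < 3) unit_normal T k j 0 l *:
       fluxH e M (event t (cell_center T j)) (W j) l).
Proof.
move=> S sumA; set vol := volI T k.
pose Fl j l := fluxH e M (event t (cell_center T j)) (W j) l.
pose N j i := \sum_(l < 3) unit_normal T k j 0 l *: Fl i l.
have own : \sum_(j <- nbr T k) areaE T k j *: N j k = 0.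
  under eq_bigr do rewrite scaler_sumr.
  rewrite exchange_big big1//= => l _.
  under eq_bigr do rewrite scalerA.
  rewrite -scaler_suml; have /rowP/(_ l) := sum_area_normal T k.
  rewrite summxE mxE => E; rewrite -[RHS](scale0r (Fl k l)); congr (_ *: _).
  by apply: etrans E; apply: eq_bigr => j _; rewrite mxE.
have sumE : \sum_(j <- nbr T k) areaE T k j *:
    numflux e M (unit_normal T k j) (a k j) (event t (cell_center T k))
      (event t (cell_center T j)) (W k) (W j) =
    (sumA / 2) *: W k - 2^-1 *: \sum_(j <- nbr T k) areaE T k j *: (a k j *: W j - N j j).
  transitivity (2^-1 *: \sum_(j <- nbr T k) areaE T k j *: N j k +
      ((sumA / 2) *: W k - 2^-1 *: \sum_(j <- nbr T k) areaE T k j *: (a k j *: W j - N j j))).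
    rewrite /sumA mulr_suml scaler_suml !scaler_sumr -sumrB -big_split/=.
    apply: eq_bigr => j _; rewrite /numflux.
    under eq_bigr do rewrite scalerDr.
    rewrite big_split/= -/(N j k) -/(N j j).
    by apply/colP => i; rewrite !mxE; ring.
  by rewrite own scaler0 add0r.
rewrite /LxF_update sumE -/S -/vol.
have -> : (2 * vol)^-1 = vol^-1 / 2 by rewrite invfM mulrC.
move: (\sum_(j <- _) _ *: (_ - _)) => Y.
by apply/colP => i; rewrite !mxE; ring.
Qed.

Theorem theorem1 (R : realType) (e : R -> R -> R) (he : is_eos e)
    (Om : set 'rV[R]_4) (M : adm R) (hM : is_spacetime Om M)
    (X : set 'rV[R]_3) (K : eqType) (T : mesh X K)
    (t dt : nat -> R)
    (hdt : forall n, 0 < dt n) (ht : forall n, t n.+1 = t n + dt n)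
    (hOm : forall n x, X x -> Om (event (t n) x))
    (eta : 'rV[R]_3 -> 'rV[R]_4 -> 'cV[R]_5 -> R)
    (heta : is_speed_bound e M eta)
    (W : nat -> K -> 'cV[R]_5) (a : nat -> K -> K -> R)
    (ha : forall n k j, j \in nbr T k ->
       Num.max (eta (unit_normal T k j) (event (t n) (cell_center T k)) (W n k))
               (eta (unit_normal T k j) (event (t n) (cell_center T j)) (W n j))
         <= a n k j)
    (hscheme : forall n k,
       W n.+1 k = LxF_update e M T (t n) (dt n) (a n) (W n) k)
    (hCFL : forall n, CFL e M T (t n) (dt n) (a n) (W n))
    (hW0 : forall k, Gstar (W 0%N k)) :
  forall n k, Gstar (W n k).
Proof.
elim=> [//|n IH] k; rewrite hscheme.
have hx j : Om (event (t n) (cell_center T j)) by exact: hOm _ _ (mesh_center T j).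
set x := event (t n) (cell_center T k); set S := sourceS e M x (W n k).
set vol := volI T k; set sumA := \sum_(j <- nbr T k) a n k j * areaE T k j.
have vol0 : 0 <= vol by apply: fine_ge0; exact: measure_ge0.
(* The term of the cell [k] is bounded by the supremum in [CFL]. *)
have cfl : dt n * ((2 * vol)^-1 * sumA + lambdaS (W n k) S) < 1.
  rewrite -lte_fin EFinM; apply: le_lt_trans (hCFL n).
  rewrite lee_pmul2l ?lte_fin//; apply: ereal_sup_ubound; by exists k.
pose th := 1 - dt n * ((2 * vol)^-1 * sumA).
have th_lam : dt n * lambdaS (W n k) S < th by rewrite /th; move: cfl; rewrite mulrDr; lra.
pose Z j := a n k j *: W n j - \sum_(l < 3) unit_normal T k j 0 l *:
  fluxH e M (event (t n) (cell_center T j)) (W n j) l.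
have -> : LxF_update e M T (t n) (dt n) (a n) (W n) k =
    (th *: W n k + dt n *: S) +
    (dt n / vol / 2) *: \sum_(j <- nbr T k) areaE T k j *: Z j.
  exact: LxF_update_split.
have [Z0 qZ] : 0 <= (\sum_(j <- nbr T k) areaE T k j *: Z j) ord0 0 /\
    0 <= qfun (\sum_(j <- nbr T k) areaE T k j *: Z j).
  apply: cone_sum => j jk; first exact/ltW/mesh_face.
  apply: (flux_in_cone he hM (hx j) heta) => //; first exact: unit_normal_neq0.
  by apply: le_trans (ha n k j jk); rewrite le_max lexx orbT.
have c0 : 0 <= dt n / vol / 2 by rewrite !divr_ge0// ltW.
(* The first component receives nothing from the source, and its weight [th] is positive because
   [th] exceeds [dt n * lambdaS], which is nonnegative. *)
have [W0 qW] := IH k; split.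
  have S0 : S ord0 0 = 0 by exact: sourceS_row0.
  have comp0 (A B C : 'cV[R]_5) (p q r : R) : (p *: A + q *: B + r *: C) ord0 0 =
    p * A ord0 0 + q * B ord0 0 + r * C ord0 0 by rewrite !mxE.
  rewrite comp0 S0 mulr0 addr0; apply: ltr_wpDr; first exact: mulr_ge0.
  rewrite mulr_gt0//; apply: le_lt_trans th_lam.
  by rewrite mulr_ge0 ?lambdaS_ge0// ltW.
apply: lt_le_trans (qfunD _ _).
apply: ltr_wpDr; first by rewrite qfunZ// mulr_ge0.
exact: qfun_lambdaS.
Qed.
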